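(* Let $\widehat m^p=(\widehat m^p_{ij})$ be the estimator $\widehat m^p_{ij}=\widehat m^p_{i\cdot}\,\widehat p_{ij}$ with $\widehat m^p_{i\cdot}=(X_{i\cdot}+X^*_i)/(n+n^* )$ (first-stage MLE from the pooled sample) and $\widehat p_i=(\widehat p_{ij})_j$ the MLE of the $i$-th second-stage model from the present sample. Then, as $n,n^*\to\infty$, its risk satisfies $$ \begin{aligned} \overset{-1}{ED}[\widehat m^p:m]&=\frac{1}{2(n+n^* )}(I-1)+\frac{1}{2n}\sum_{i=1}^I s_i+\frac{1}{12(n+n^* )^2}(M_f-1)\\ &\quad+\frac{1}{24n^2}\sum_{i=1}^I m_{i\cdot}^{-1}\Bigl(A_{(i)}+12(1-m_{i\cdot})s_i\,\frac{n^*}{n+n^*}\Bigr)+o(n^{-2})+o((n+n^* )^{-2}). \end{aligned} $$ In the special case when all second-stage models are full models, $$ \begin{aligned} \overset{-1}{ED}[\widehat m^p:m]&=\frac{1}{2(n+n^* )}(I-1)+\frac{1}{2n}(p-I+1)+\frac{1}{12(n+n^* )^2}(M_f-1)\\ &\quad+\frac{1}{12n^2}\Bigl(M-M_f+\frac{6n^*}{n+n^*}\Bigl(\sum_{i=1}^I m_{i\cdot}^{-1}J_i-M_f-(p-I+1)\Bigr)\Bigr)\\ &\quad+o(n^{-2})+o((n+n^* )^{-2}). \end{aligned} $$ Here $M_f=\sum_{i=1}^I m_{i\cdot}^{-1}$, $M=\sum_{i=1}^I\sum_{j=1}^{J_i}m_{ij}^{-1}$ and $p=\sum_{i=1}^I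 J_i-1$.
   Context: Two-stage multinomial model. There are categories $C_{ij}$, $i=1,\dots,I$, $j=1,\dots,J_i$ ($J_i\ge 1$), with fixed true probabilities $m=(m_{ij})$, $m_{ij}>0$, $\sum_{i,j}m_{ij}=1$. Put $m_{i\cdot}=\sum_{j=1}^{J_i}m_{ij}$, $p_{ij}=m_{ij}/m_{i\cdot}$, $m_f=(m_{1\cdot},\dots,m_{I\cdot})$, $p_i=(p_{i1},\dots,p_{iJ_i})$. The first-stage model (for $m_f$) is a full model: no restriction other than positivity and summing to 1, so its dimension is $I-1$. The $i$-th second-stage model is a parametric model for $p_i$ (multinomial on the $J_i$ categories $C_{i1},\dots,C_{iJ_i}$, conditional on membership in $C_{i\cdot}=\bigcup_j C_{ij}$) of dimension $s_i\le J_i-1$; it is called full if $s_i=J_i-1$, i.e. no restriction on $p_i$ other than positivity and summing to 1. If $J_i=1$ then $p_{i1}=\widehat p_{i1}=1$ and there is no unknown parameter. Present survey: a random sample of size $n$ from this model, with counts $X_{ij}$ in $C_{ij}$, i.e. $(X_{ij})$ is multinomial with size $n$ and probabilities $(m_{ij})$; $X_{i\cdot}=\sum_j X_{ij}$. Prior survey: a random sample of size $n^*$, independent of the present survey, recording only the first-stage categories: $(X^*_1,\dots,X^*_I)$ is multinomial with size $n^*$ and probabilities $m_f$. Second-stage estimator: $\widehat p_i=(\widehat p_{i1},\dots,\widehat p_{iJ_i})$ is the maximum likelihood estimator of $p_i$ in the $i$-th second-stage model based on $(X_{i1},\dots,X_{iJ_i})$, which conditionally on $X_{i\cdot}$ is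 a multinomial sample of size $X_{i\cdot}$ with probabilities $p_i$; for a full model $\widehat p_{ij}=X_{ij}/X_{i\cdot}$. Kullback–Leibler divergence and risk: for probability vectors, $\overset{-1}{D}[q:r]=\sum_k q_k\log(q_k/r_k)$ (with $0\log 0=0$), so $\overset{-1}{D}[\widehat m^p:m]=\sum_{i,j}\widehat m^p_{ij}\log(\widehat m^p_{ij}/m_{ij})$; the risk is $\overset{-1}{ED}[\widehat m^p:m]=E\bigl[\overset{-1}{D}[\widehat m^p:m]\bigr]$. Samples with some $X_{i\cdot}=0$ are discarded: expectations are taken conditionally on the event $X_{i\cdot}\ne0$ for all $1\le i\le I$. Coefficients $A_{(i)}$: $A_{(i)}$ denotes the coefficient of $1/(24n^2)$ in the asymptotic expansion of the risk of the MLE of the $i$-th second-stage model when that model is observed with a (non-random) sample size $n$; that is, the $i$-th second-stage model is such that, for the MLE $\widehat p_i$ based on a multinomial sample of size $n$ with probabilities $p_i$, $$E\bigl[\overset{-1}{D}[\widehat p_i:p_i]\bigr]=\frac{s_i}{2n}+\frac{1}{24n^2}A_{(i)}+o(n^{-2})\quad (n\to\infty).$$ *)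

(* Defs.v *)
(* MathComp with MathComp-Analysis. *)
From HB Require Import structures.
From mathcomp Require Import all_boot all_order all_algebra.
From mathcomp Require Import all_classical all_reals all_analysis.

Set Implicit Arguments.
Unset Strict Implicit.
Unset Printing Implicit Defensive.

Import Order.TTheory GRing.Theory Num.Theory numFieldNormedType.Exports.
Local Open Scope classical_set_scope.
Local Open Scope ring_scope.

(* Since [ln 0 = 0] and [0 * _ = 0], this follows the convention
   0 log 0 = 0; it is used with [r] positive. *)
Definition KL (R : realType) (T : finType) (q r : T -> R) : R :=
  \sum_t q t * ln (q t / r t).

(* A random sample of size [n] from the distribution [q] on the categories [T]
   is a point [w] of the product space; the vector [counts w] is then
   multinomial with size [n] and probabilities [q]. *)
Definition sample_pr (R : realType) (T : finType) (q : T -> R) (n : nat)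
    (w : {ffun 'I_n -> T}) : R :=
  \prod_k q (w k).

Definition counts (T : finType) (n : nat) (w : {ffun 'I_n -> T}) :
    {ffun T -> nat} :=
  [ffun t => #|[set k | w k == t]%SET|].

Definition cond_expectation (R : realType) (W : finType) (P : W -> R)
    (G : pred W) (F : W -> R) : R :=
  (\sum_(w | G w) P w * F w) / \sum_(w | G w) P w.

Section SecondStageModel.
Variables (R : realType) (J : nat).

Definition open_simplex : set 'rV[R]_J :=
  [set q | (forall j, 0 < q 0 j) /\ \sum_j q 0 j = 1].

(* The rank condition on the Jacobian is what makes [model_dim] the dimension of
   the model and not merely the number of its parameters. *)
Record parametric_model := ParametricModel {
  model_dim : nat;
  param_space : set 'rV[R]_model_dim;
  param : 'rV[R]_model_dim -> 'rV[R]_J;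
  model_dim_le : (model_dim <= J.-1)%N;
  param_space_open : open param_space;
  param_prob : forall theta, param_space theta -> open_simplex (param theta);
  param_differentiable :
    forall theta, param_space theta -> differentiable param theta;
  param_rank : forall theta, param_space theta ->
    \rank ('J param theta) = model_dim
}.

Arguments param_space : clear implicits.
Arguments param : clear implicits.

Definition model_set (S : parametric_model) : set 'rV[R]_J :=
  param S @` param_space S.

Definition full_model (S : parametric_model) : Prop :=
  model_dim S = J.-1 /\ model_set S = open_simplex.

Definition likelihood (x : {ffun 'I_J -> nat}) (q : 'rV[R]_J) : R :=
  \prod_j q 0 j ^+ x j.

(* The likelihood is maximized over the closure of the model: when some counts
   vanish it need not attain its supremum on the model itself (for a full model
   the maximizer x_j / sum x then has zero coordinates). *)
Definition is_MLE (S : parametric_model) (x : {ffun 'I_J -> nat})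
    (q : 'rV[R]_J) : Prop :=
  closure (model_set S) q /\
  forall r, closure (model_set S) r -> likelihood x r <= likelihood x q.

Definition second_stage_risk (phat : {ffun 'I_J -> nat} -> 'rV[R]_J)
    (q : 'rV[R]_J) (n : nat) : R :=
  \sum_(w : {ffun 'I_n -> 'I_J})
    sample_pr (q 0) w * KL (phat (counts w) 0) (q 0).

(* [A] is the coefficient of 1 / (24 n^2) in the expansion of the risk of
   [phat] at [q]. *)
Definition has_second_order_coef (S : parametric_model)
    (phat : {ffun 'I_J -> nat} -> 'rV[R]_J) (q : 'rV[R]_J) (A : R) : Prop :=
  (fun n : nat => second_stage_risk phat q n
     - ((model_dim S)%:R / (2 * n%:R) + 1 / (24 * n%:R ^+ 2) * A))
  =o_\oo (fun n : nat => (n%:R ^- 2 : R)).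

End SecondStageModel.

Section TwoStage.
Variables (R : realType) (I : nat) (J : 'I_I -> nat).

Definition category : finType := {i : 'I_I & 'I_(J i)}.

Definition cell (i : 'I_I) (j : 'I_(J i)) : category :=
  Tagged (fun i => 'I_(J i)) j.
Arguments cell : clear implicits.

Definition first_stage (m : category -> R) (i : 'I_I) : R :=
  \sum_(j < J i) m (cell i j).

Definition second_stage (m : category -> R) (i : 'I_I) : 'rV[R]_(J i) :=
  \row_j (m (cell i j) / first_stage m i).

Definition row_counts (x : {ffun category -> nat}) (i : 'I_I) :
    {ffun 'I_(J i) -> nat} :=
  [ffun j => x (cell i j)].

Definition row_total (x : {ffun category -> nat}) (i : 'I_I) : nat :=
  (\sum_(j < J i) x (cell i j))%N.

Variable phat : forall i : 'I_I, {ffun 'I_(J i) -> nat} -> 'rV[R]_(J i).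

Definition pooled_estimator (n ns : nat) (x : {ffun category -> nat})
    (xs : {ffun 'I_I -> nat}) (c : category) : R :=
  (row_total x (tag c) + xs (tag c))%:R / (n + ns)%:R
  * phat (row_counts x (tag c)) 0 (tagged c).

(* [w.1] is the present survey and [w.2] the independent prior survey;
   conditioning is on all the first-stage counts of the present survey being
   nonzero. *)
Definition pooled_risk (m : category -> R) (n ns : nat) : R :=
  cond_expectation
    (fun w : {ffun 'I_n -> category} * {ffun 'I_ns -> 'I_I} =>
       sample_pr m w.1 * sample_pr (first_stage m) w.2)
    (fun w => [forall i, row_total (counts w.1) i != 0%N])
    (fun w => KL (pooled_estimator n ns (counts w.1) (counts w.2)) m).

End TwoStage.
Arguments cell {I J} i j.

Local Notation oo2 := (filter_prod \oo \oo).

(* [f] and [g] differ by an o(n^-2) + o((n + n')^-2) as n and n' tend to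
   infinity, independently of each other. *)
Definition expands_to (R : realType) (f g : nat -> nat -> R) : Prop :=
  exists r1 r2 : nat * nat -> R,
    [/\ r1 =o_ oo2 (fun N => N.1%:R ^- 2 : R),
        r2 =o_ oo2 (fun N => (N.1 + N.2)%:R ^- 2 : R) &
        forall n ns, f n ns = g n ns + r1 (n, ns) + r2 (n, ns)].

(* Main.v *)
Require Import Defs.
From HB Require Import structures.
From mathcomp Require Import all_boot all_order all_algebra.
From mathcomp Require Import all_classical all_reals all_analysis.
From mathcomp Require Import ring lra.
Import Order.TTheory GRing.Theory Num.Theory numFieldNormedType.Exports.
Local Open Scope classical_set_scope.
Local Open Scope ring_scope.

(** Write X_i for the first-stage counts of the present survey, X'_i for those
    of the prior survey of size n', and N = n + n'. The idea is to split the
    loss by the chain rule for the Kullback-Leibler divergence: on the event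
    that no X_i vanishes ([KL_pooled]),

      KL(estimate : m) = sum_i phi_i((X_i + X'_i) / N)
                         + sum_i (X_i + X'_i) / N * KL(phat_i : p_i)

    with phi_i(x) = x ln (x / m_i). Every summand then has an expectation
    that is an integral against a binomial law ([mean_pooled_loss]).

    First stage. X_i + X'_i is binomial with parameters N and m_i. In the
    relative deviation t = X / E[X] - 1, the function (1 + t) ln (1 + t) equals
    its Taylor polynomial of degree 5 up to an error between 0 and t^6 / 5
    ([xlogx_taylor_bounds]), and E[t^6] = O(N^-3); so the second, third and
    fourth central moments of the binomial law give the expansion
    ([binmean_xlogx]).

    Second stage. Given X_i = k, row i is a multinomial sample of size k, so
    its estimator has expected loss R_i(k) = s_i / (2 k) + A_i / (24 k^2)
    + o(k^-2) and the summand has mean E[(X_i + n' m_i) / N * R_i(X_i)]. Only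
    E[1 / X_i] to second order and E[1 / X_i^2] to first order are needed. The
    factor X_i cancels the leading 1 / X_i exactly, so the correction
    (1 - m_i) / (n m_i)^2 of E[1 / X_i] enters only through the prior survey:
    this is where the terms with n' / N come from ([binmean_weighted_risk]).

    Conditioning. Since t = -1 when X_i = 0, the probability that some X_i
    vanishes is at most a sum of sixth moments, hence O(n^-3); as the loss is
    bounded, discarding these samples changes the risk by O(n^-3)
    ([pooled_risk_close]).

    Full models. By the strict Gibbs inequality the maximum likelihood
    estimator is the vector of relative frequencies ([full_MLE]), whose risk
    is again a sum of expectations of x ln x at binomial variables; thus
    A_i = 2 (sum_j 1 / p_ij - 1) ([full_second_order_coef]) and the second
    expansion is the first one with these coefficients.

    All errors are o(n^-2) uniformly in n', so the remainder of order
    o((n + n')^-2) can be taken to be zero. Since [0^-1 = 0], the expression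
    1 / X makes sense at X = 0, where it vanishes. *)

Set Implicit Arguments.
Unset Strict Implicit.
Unset Printing Implicit Defensive.

(* Closes goals stating that a polynomial expression in nonnegative quantities
   and their inverses is nonnegative. *)
Ltac nonneg := repeat first
  [ done | assumption | apply: ltW; assumption | apply: ler0n
  | apply: normr_ge0 | apply: addr_ge0 | apply: mulr_ge0
  | apply: exprn_ge0 | rewrite invr_ge0 ].

(** * Polynomial bounds for x ln x *)

Section LogBounds.
Variable R : realType.
Implicit Types x t : R.

(** The sign condition makes [f] decrease before 1 and increase after it. *)
Lemma min_at_one (f df : R -> R) :
  (forall x, 0 < x -> is_derive x 1 f (df x)) ->
  (forall x, 0 < x -> 0 <= (x - 1) * df x) ->
  forall x, 0 < x -> f 1 <= f x.
Proof.
move=> fdf df_sign x x0.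
have cont a b : 0 < a -> {within `[a, b], continuous f}.
  move=> a0; apply: derivable_within_continuous => y.
  rewrite in_itv/= => /andP[ay _].
  by have [] := fdf y (lt_le_trans a0 ay).
have [x1|x1|->//] := ltgtP x 1.
- have [|c /[!in_itv]/= /andP[xc c1]] := MVT (df := df) x1 _ (cont _ _ x0).
    by move=> y /[!in_itv]/= /andP[xy _]; apply: fdf; exact: lt_trans xy.
  move=> Ef; have := df_sign c (lt_trans x0 xc).
  rewrite nmulr_rge0 ?subr_lt0// => dc.
  by rewrite -subr_le0 Ef mulr_le0_ge0// subr_ge0 ltW.
- have [|c /[!in_itv]/= /andP[c1 xc]] := MVT (df := df) x1 _ (cont _ _ ltr01).
    by move=> y /[!in_itv]/= /andP[xy _]; apply: fdf; exact: lt_trans xy.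
  move=> Ef; have := df_sign c (lt_trans ltr01 c1).
  rewrite pmulr_rge0 ?subr_gt0// => dc.
  by rewrite -subr_ge0 Ef mulr_ge0// subr_ge0 ltW.
Qed.

(** The Taylor polynomial at 0 of (1 + t) ln (1 + t). *)
Definition xlogx_taylor t : R :=
  t + t ^+ 2 / 2 - t ^+ 3 / 6 + t ^+ 4 / 12 - t ^+ 5 / 20.

(** Dividing by [x] turns both inequalities into statements about ln plus a
    rational function. The differences of the two sides then have derivatives
    (x - 1)^5 / (5 x^2) and (x - 1)^5 / x, of the sign of x - 1, so
    [min_at_one] applies. As the bounds hold on the whole half-line, large
    deviations require no separate treatment. *)
Lemma xlogx_taylor_bounds x : 0 <= x ->
  xlogx_taylor (x - 1) <= x * ln x <= xlogx_taylor (x - 1) + (x - 1) ^+ 6 / 5.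
Proof.
rewrite le_eqVlt => /orP[/eqP<-|x0].
  by rewrite mul0r /xlogx_taylor; lra.
apply/andP; split.
(* xlogx_taylor t = (1 + t) Q(t) - 1/5, and the function below is
   ln y - Q (y - 1) + 1 / (5 y). *)
- have /= := @min_at_one (fun y => ln y - (5^-1 + 4 / 5 * (y - 1)
    - 3 / 10 * (y - 1) ^+ 2 + 2 / 15 * (y - 1) ^+ 3
    - 20^-1 * (y - 1) ^+ 4) + 5^-1 * y^-1)
    (fun y => (y - 1) ^+ 5 / (5 * y ^+ 2)).
  move=> /(_ _ _ x x0); rewrite ln1 subrr => H.
  have {}H : 0 <= ln x - (5^-1 + 4 / 5 * (x - 1) - 3 / 10 * (x - 1) ^+ 2
      + 2 / 15 * (x - 1) ^+ 3 - 20^-1 * (x - 1) ^+ 4) + 5^-1 * x^-1.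
    apply: le_trans (H _ _) => {H}; first by lra.
      move=> y y0; have y0' : y != 0 by rewrite gt_eqF.
      have D1 := is_derive1_ln y0.
      have D2 : is_derive y 1 (fun z : R => z^-1) (- y ^- 2 *: 1) by exact: is_deriveV.
      apply: is_derive_eq; rewrite /GRing.scale/=.
      by field.
    move=> y y0; rewrite mulrA -exprS; apply: divr_ge0; first exact: exprn_even_ge0.
    by rewrite mulr_ge0 ?sqr_ge0.
  move/(mulr_ge0 (ltW x0)): H; rewrite mulrDr [x * (5^-1 * _)]mulrCA divff ?gt_eqF//.
  by rewrite /xlogx_taylor; lra.
- have /= := @min_at_one (fun y => - ln y + ((y - 1) - (y - 1) ^+ 2 / 2
    + (y - 1) ^+ 3 / 3 - (y - 1) ^+ 4 / 4 + (y - 1) ^+ 5 / 5))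
    (fun y => (y - 1) ^+ 5 / y).
  move=> /(_ _ _ x x0); rewrite ln1 subrr => H.
  have {}H : 0 <= - ln x + ((x - 1) - (x - 1) ^+ 2 / 2
    + (x - 1) ^+ 3 / 3 - (x - 1) ^+ 4 / 4 + (x - 1) ^+ 5 / 5).
    apply: le_trans (H _ _) => {H}; first by lra.
      move=> y y0; have y0' : y != 0 by rewrite gt_eqF.
      have D1 := is_derive1_ln y0.
      apply: is_derive_eq; rewrite /GRing.scale/=.
      by field.
    move=> y y0; rewrite mulrA -exprS; apply: divr_ge0; last exact: ltW.
    exact: exprn_even_ge0.
  by move/(mulr_ge0 (ltW x0)): H; rewrite /xlogx_taylor; lra.
Qed.

Lemma norm_xlogx_ratio (y r : R) : 0 <= y <= 1 -> 0 < r ->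
  `|y * ln (y / r)| <= 1 + `|ln r|.
Proof.
move=> /andP[]; rewrite le_eqVlt => /orP[/eqP<- _ r0|y0 y1 r0].
  by rewrite mul0r normr0 addr_ge0.
rewrite ln_div ?posrE// mulrBr (le_trans (ler_normB _ _))// lerD//.
  rewrite ler0_norm; last by apply: mulr_ge0_le0; [exact: ltW|exact: ln_le0].
  have := @le_ln1Dx R (y^-1 - 1); rewrite [1 + _]addrC subrK lnV ?posrE// => H.
  have {}H : - ln y <= y^-1 - 1.
    by apply: H; have : 0 < y^-1 by [rewrite invr_gt0]; lra.
  have := ler_wpM2l (ltW y0) H; rewrite mulrBr divff ?gt_eqF//; lra.
by rewrite normrM (ger0_norm (ltW y0)) ler_piMl.
Qed.

End LogBounds.

(** * Binomial expectations and their central moments *)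

Section Binomial.
Variable R : realType.
Implicit Types (q : R) (f g : nat -> R).

(** The expectation of f(X) for X binomial with parameters n and q, by
    conditioning on one trial; this form makes every identity below an
    induction on [n]. *)
Fixpoint binmean q n f : R :=
  if n is n'.+1 then q * binmean q n' (f \o succn) + (1 - q) * binmean q n' f
  else f 0%N.

Lemma eq_binmean q n f g : f =1 g -> binmean q n f = binmean q n g.
Proof. by move=> /funext->. Qed.

Lemma binmeanD q n f g :
  binmean q n (fun k => f k + g k) = binmean q n f + binmean q n g.
Proof.
elim: n f g => //= n IH f g.
rewrite (IH (f \o succn) (g \o succn)) IH; ring.
Qed.

Lemma binmeanZ q n c f : binmean q n (fun k => c * f k) = c * binmean q n f.
Proof.
elim: n f => //= n IH f; rewrite (IH (f \o succn)) IH; ring.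
Qed.

Lemma binmean_cst q n c : binmean q n (fun=> c) = c.
Proof. by elim: n => //= n IH; rewrite /comp IH; ring. Qed.

Lemma binmean_sum q n (T : finType) (F : T -> nat -> R) :
  binmean q n (fun k => \sum_t F t k) = \sum_t binmean q n (F t).
Proof.
elim: n F => //= n IH F.
by rewrite /comp (IH (fun t k => F t k.+1)) IH big_split/= -!mulr_sumr.
Qed.

Lemma le_binmean q n f g : 0 <= q <= 1 ->
  (forall k, (k <= n)%N -> f k <= g k) -> binmean q n f <= binmean q n g.
Proof.
move=> /andP[q0 q1]; elim: n f g => [|n IH] f g fg /=; first exact: fg.
apply: lerD; apply: ler_wpM2l; rewrite ?subr_ge0//; apply: IH => k kn.
  exact: fg.
by apply: fg; rewrite (leq_trans kn).
Qed.

Lemma ler_norm_binmean q n f g : 0 <= q <= 1 ->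
  (forall k, (k <= n)%N -> `|f k| <= g k) -> `|binmean q n f| <= binmean q n g.
Proof.
move=> q01 fg; rewrite ler_norml -mulN1r -binmeanZ; apply/andP; split.
  by apply: le_binmean => // k /fg; rewrite ler_norml mulN1r => /andP[].
by apply: le_binmean => // k /fg; rewrite ler_norml => /andP[].
Qed.

(** The sum of independent binomial variables with the same success
    probability is binomial. *)
Lemma binmean_add q a b f :
  binmean q a (fun k => binmean q b (fun l => f (k + l)%N)) =
  binmean q (a + b) f.
Proof.
by elim: a f => //= n IH f; rewrite -IH -IH.
Qed.

Lemma binmean_id q n : binmean q n (fun k => k%:R) = n%:R * q.
Proof.
elim: n => [|n IH] /=; first by rewrite mul0r.
rewrite (@eq_binmean _ _ _ (fun k => 1 + k%:R)); last by move=> k; rewrite /= -natr1 addrC.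
rewrite binmeanD binmean_cst IH -natr1; ring.
Qed.

Section Moments.
Variable q : R.
Let v : R := q * (1 - q).
Definition central_moment r n : R :=
  binmean q n (fun k => (k%:R - n%:R * q) ^+ r).

(** One more trial shifts the centred variable by 1 - q with probability q and
    by - q otherwise; expand the power of the sum. *)
Lemma central_momentS r n : central_moment r n.+1 =
  \sum_(i < r.+1) (q * (1 - q) ^+ (r - i) + (1 - q) * (- q) ^+ (r - i))
     * 'C(r, i)%:R * central_moment i n.
Proof.
have shift c : binmean q n (fun k => (c + (k%:R - n%:R * q)) ^+ r) =
    \sum_(i < r.+1) c ^+ (r - i) * 'C(r, i)%:R * central_moment i n.
  rewrite (@eq_binmean _ _ _ (fun k => \sum_(i < r.+1)
      c ^+ (r - i) * 'C(r, i)%:R * (k%:R - n%:R * q) ^+ i)); last first.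
    by move=> k; rewrite exprDn; apply: eq_bigr => i _; rewrite -mulr_natr mulrAC.
  by rewrite binmean_sum; apply: eq_bigr => i _; rewrite binmeanZ.
rewrite /central_moment /= -/(central_moment _ _).
rewrite (@eq_binmean _ _ (_ \o _) (fun k => ((1 - q) + (k%:R - n%:R * q)) ^+ r)); last first.
  by move=> k /=; rewrite -!natr1; congr (_ ^+ _); ring.
rewrite (@eq_binmean _ _ (fun k : nat => (k%:R - n.+1%:R * q) ^+ r)
    (fun k => (- q + (k%:R - n%:R * q)) ^+ r)); last first.
  by move=> k /=; rewrite -!natr1; congr (_ ^+ _); ring.
rewrite !shift !mulr_sumr -big_split /=; apply: eq_bigr => i _.
by rewrite !mulrDl !mulrA.
Qed.

Lemma central_moments n : let N : R := n%:R in
  [/\ central_moment 0 n = 1, central_moment 1 n = 0,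
      central_moment 2 n = N * v,
      central_moment 3 n = N * v * (1 - 2 * q) &
      [/\ central_moment 4 n = 3 * N ^+ 2 * v ^+ 2 + N * v * (1 - 6 * v),
      central_moment 5 n =
        v * (1 - 2 * q) * (N * (1 - 12 * v) + 10 * N ^+ 2 * v) &
      central_moment 6 n = 15 * N ^+ 3 * v ^+ 3
        + N ^+ 2 * (25 * v ^+ 2 - 130 * v ^+ 3)
        + N * v * (1 - 30 * v + 120 * v ^+ 2)]].
Proof.
move=> N; rewrite /N {N}; elim: n => [|n [E0 E1 E2 E3 [E4 E5 E6]]].
  by rewrite /central_moment /= !mul0r subrr !expr0n /=; split; last split; ring.
have M0 : central_moment 0 n.+1 = 1.
  by rewrite /central_moment (@eq_binmean _ _ _ (fun=> 1)) ?binmean_cst.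
split=> //; last split.
all: rewrite central_momentS !big_ord_recr big_ord0 /= ?E0 E1 ?E2 ?E3 ?E4 ?E5 ?E6.
all: rewrite ?binE -natr1 /v; ring.
Qed.
End Moments.
End Binomial.

(** * Asymptotics of binomial expectations *)

Section RelativeDeviation.
Variables (R : realType) (q : R).
Hypotheses (q_gt0 : 0 < q) (q_le1 : q <= 1).

(** The relative deviation k / E[X] - 1 of a binomial variable. *)
Definition reldev (n k : nat) : R := (k%:R - n%:R * q) / (n%:R * q).

Lemma reldev1D n k : (0 < n)%N -> n%:R * q * (1 + reldev n k) = k%:R.
Proof.
move=> n0; have N0 : n%:R != 0 :> R by rewrite pnatr_eq0 -lt0n.
by rewrite /reldev; field; rewrite N0 gt_eqF.
Qed.

(** Up to order 3 the moments are exact; from order 4 on only what survives at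
    order n^-2 is kept. The constant 4 / q^6 is a crude common bound. *)
Lemma reldev_moments n : (0 < n)%N ->
  let N : R := n%:R in let mom r := binmean q n (fun k => reldev n k ^+ r) in
  [/\ mom 0 = 1, mom 1 = 0, mom 2 = (1 - q) / (q * N),
      mom 3 = (1 - q) * (1 - 2 * q) / (q * N) ^+ 2 &
      [/\ `|mom 4 - 3 * (1 - q) ^+ 2 / (q * N) ^+ 2| <= 4 / q ^+ 6 / N ^+ 3,
          `|mom 5| <= 4 / q ^+ 6 / N ^+ 3 & mom 6 <= 4 / q ^+ 6 / N ^+ 3]].
Proof.
move=> n0 N mom.
have N1 : 1 <= N by rewrite ler1n.
have N0 : 0 < N := lt_le_trans ltr01 N1.
have momE r : mom r = central_moment q r n / (N * q) ^+ r.
  rewrite /mom /central_moment mulrC -binmeanZ; apply: eq_binmean => k.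
  by rewrite /reldev expr_div_n mulrC.
have [E0 E1 E2 E3 [E4 E5 E6]] := central_moments q n.
rewrite -/N in E2 E3 E4 E5 E6.
have q_neq0 : q != 0 by rewrite gt_eqF.
have N_neq0 : N != 0 by rewrite gt_eqF.
have qq : 0 <= q * (1 - q) <= 1 / 4.
  apply/andP; split; first by rewrite mulr_ge0 ?subr_ge0 ?(ltW q_gt0).
  by have := sqr_ge0 (q - 1 / 2); lra.
have scaled r (x : R) : (r <= 3)%N -> `|x| <= 4 * N ^+ r ->
    `|x / (N * q) ^+ (r + 3)| <= 4 / q ^+ 6 / N ^+ 3.
  move=> r3 xN; have Nq0 : 0 < (N * q) ^+ (r + 3).
    by rewrite exprn_gt0// mulr_gt0.
  rewrite normrM normfV (gtr0_norm Nq0) ler_pdivrMr//; apply: le_trans xN _.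
  rewrite exprMn exprD [leRHS](_ : _ = 4 * N ^+ r * (q ^+ (r + 3) / q ^+ 6)); last first.
    by field; rewrite N_neq0 q_neq0.
  rewrite ler_peMr ?mulr_ge0 ?exprn_ge0 ?(ltW N0)//.
  by rewrite ler_pdivlMr ?exprn_gt0// mul1r ler_wiXn2l ?(ltW q_gt0)// (leq_add r3 (leqnn 3)).
have pow_le a b (x c : R) : (a <= b)%N -> `|x| <= c -> `|N ^+ a * x| <= c * N ^+ b.
  move=> ab xc; have Na : 0 <= N ^+ a by rewrite exprn_ge0 ?ltW.
  rewrite normrM (ger0_norm Na) mulrC; apply: ler_pM => //.
  exact: ler_weXn2l.
rewrite !momE E0 E1 E2 E3 E4 E5 E6.
split; [by rewrite expr0 divr1|by rewrite mul0r|by field; rewrite N_neq0 q_neq0|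
  by field; rewrite N_neq0 q_neq0|split].
all: set v := q * (1 - q) in qq E2 E3 E4 E5 E6 *;
  have [v0 v14] := andP qq; have q0 := q_gt0; have q1 := q_le1.
- rewrite (_ : _ - _ = N ^+ 1 * (v * (1 - 6 * v)) / (N * q) ^+ (1 + 3)).
    apply: scaled => //; apply: pow_le => //; rewrite normrM.
    rewrite -[4]mulr1; apply: ler_pM => //; rewrite ler_norml; apply/andP; split; lra.
  by rewrite /v; field; rewrite N_neq0 q_neq0.
- apply: (scaled 2%N) => //.
  rewrite (_ : v * _ * _ = N ^+ 1 * (v * (1 - 2 * q) * (1 - 12 * v))
     + N ^+ 2 * (v * (1 - 2 * q) * (10 * v))); last by ring.
  have v1 : `|v * (1 - 2 * q)| <= 1 / 4.
    rewrite normrM (@le_trans _ _ (1 / 4 * 1))//; last by lra.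
    by apply: ler_pM => //; rewrite ler_norml; apply/andP; split; lra.
  apply: (@le_trans _ _ (2 * N ^+ 2 + 2 * N ^+ 2)); last by lra.
  apply: le_trans (ler_normD _ _) (lerD _ _); apply: pow_le => //.
    rewrite normrM (@le_trans _ _ (1 / 4 * 2))//; last by lra.
    by apply: ler_pM => //; rewrite ler_norml; apply/andP; split; lra.
  rewrite normrM (@le_trans _ _ (1 / 4 * 3))//; last by lra.
  by apply: ler_pM => //; rewrite ler_norml; apply/andP; split; lra.
- apply: le_trans (ler_norm _) _; apply: (scaled 3%N) => //.
  rewrite (_ : _ + _ + _ = N ^+ 3 * (15 * v ^+ 3)
    + N ^+ 2 * (v ^+ 2 * (25 - 130 * v))
    + N ^+ 1 * (v * (1 - 30 * v + 120 * v ^+ 2))); last by ring.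
  have /andP[v20 v21] : 0 <= v ^+ 2 <= 1 / 16 by rewrite sqr_ge0/=; nra.
  have /andP[v30 v31] : 0 <= v ^+ 3 <= 1 / 64.
    by rewrite exprS; apply/andP; split; nra.
  apply: (@le_trans _ _ (1 / 4 * N ^+ 3 + 8 / 5 * N ^+ 3 + 43 / 20 * N ^+ 3)); last by lra.
  apply: le_trans (ler_normD _ _) (lerD _ _); last first.
    apply: pow_le => //; rewrite normrM (@le_trans _ _ (1 / 4 * (17 / 2)))//; last by lra.
    by apply: ler_pM => //; rewrite ler_norml; apply/andP; split; lra.
  apply: le_trans (ler_normD _ _) (lerD _ _); apply: pow_le => //.
    by rewrite ler_norml; apply/andP; split; lra.
  rewrite normrM (@le_trans _ _ (1 / 16 * 25))//; last by lra.
  by apply: ler_pM => //; rewrite ler_norml; apply/andP; split; lra.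
Qed.

Lemma binmean_reldev_poly n a0 a1 a2 a3 a4 a5 :
  binmean q n (fun k => a0 + a1 * reldev n k + a2 * reldev n k ^+ 2
    + a3 * reldev n k ^+ 3 + a4 * reldev n k ^+ 4 + a5 * reldev n k ^+ 5) =
  let mom r := binmean q n (fun k => reldev n k ^+ r) in
  a0 + a1 * mom 1 + a2 * mom 2 + a3 * mom 3 + a4 * mom 4 + a5 * mom 5.
Proof. by rewrite !binmeanD !binmeanZ binmean_cst. Qed.

(** The delta method: f(X) may be replaced by its Taylor polynomial in the
    relative deviation. The constant 4 / q^6 / n^3 bounds the fifth and sixth
    moments and the excess of the fourth one over its leading term. *)
Lemma binmean_expansion n (f : nat -> R) a0 a1 a2 a3 a4 a5 (C : R) : (0 < n)%N ->
  0 <= C ->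
  (forall k, (k <= n)%N -> let t := reldev n k in
    `|f k - (a0 + a1 * t + a2 * t ^+ 2 + a3 * t ^+ 3 + a4 * t ^+ 4
      + a5 * t ^+ 5)| <= C * t ^+ 6) ->
  `|binmean q n f - (a0 + a2 * ((1 - q) / (q * n%:R))
     + (a3 * (1 - q) * (1 - 2 * q) + 3 * a4 * (1 - q) ^+ 2) / (q * n%:R) ^+ 2)|
    <= (`|a4| + `|a5| + C) * (4 / q ^+ 6 / n%:R ^+ 3).
Proof.
move=> n0 C0 fC.
have [_ M1 M2 M3 [M4 M5 M6]] := reldev_moments n0.
pose p k := a0 + a1 * reldev n k + a2 * reldev n k ^+ 2
  + a3 * reldev n k ^+ 3 + a4 * reldev n k ^+ 4 + a5 * reldev n k ^+ 5.
set D := 4 / q ^+ 6 / n%:R ^+ 3 in M4 M5 M6 *.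
have {fC} fp : `|binmean q n (fun k => f k + (-1) * p k)| <= C * D.
  apply: (@le_trans _ _ (binmean q n (fun k => C * reldev n k ^+ 6))).
    apply: ler_norm_binmean => [|k /fC]; first by rewrite ltW.
    by rewrite mulN1r.
  by rewrite binmeanZ ler_wpM2l.
move: fp; rewrite binmeanD binmeanZ mulN1r.
have := binmean_reldev_poly n a0 a1 a2 a3 a4 a5; rewrite -/p => ->.
rewrite /= M1 M2 M3; set m4 := binmean _ _ _ in M4 *; set m5 := binmean _ _ _ in M5 *.
move=> fp.
rewrite [X in `|X|](_ : _ = (binmean q n f - (a0 + a1 * 0
    + a2 * ((1 - q) / (q * n%:R)) + a3 * ((1 - q) * (1 - 2 * q) / (q * n%:R) ^+ 2)
    + a4 * m4 + a5 * m5)) + a5 * m5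
    + a4 * (m4 - 3 * (1 - q) ^+ 2 / (q * n%:R) ^+ 2)); last by ring.
rewrite [leRHS](_ : _ = C * D + `|a5| * D + `|a4| * D); last by ring.
by apply: le_trans (ler_normD _ _) (lerD (le_trans (ler_normD _ _) (lerD _ _)) _);
  rewrite ?normrM ?ler_wpM2l//.
Qed.

Lemma binmean_xlogx : exists K, forall n, (0 < n)%N ->
  `|binmean q n (fun k => k%:R / n%:R * ln (k%:R / n%:R / q))
    - ((1 - q) / (2 * n%:R) + (q^-1 - q) / (12 * n%:R ^+ 2))| <= K / n%:R ^+ 3.
Proof.
exists ((q / 12 + q / 20 + q / 5) * (4 / q ^+ 6)) => n n0.
have N0 : 0 < n%:R :> R by rewrite ltr0n.
have q_neq0 : q != 0 by rewrite gt_eqF.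
have N_neq0 : n%:R != 0 :> R by rewrite gt_eqF.
have -> : (1 - q) / (2 * n%:R) + (q^-1 - q) / (12 * n%:R ^+ 2) =
   0 + (q / 2) * ((1 - q) / (q * n%:R)) + ((- q / 6) * (1 - q) * (1 - 2 * q)
     + 3 * (q / 12) * (1 - q) ^+ 2) / (q * n%:R) ^+ 2.
  by field; rewrite N_neq0 q_neq0.
have q12 : `|q / 12| = q / 12 by rewrite ger0_norm// divr_ge0// ltW.
have q20 : `|- q / 20| = q / 20.
  by rewrite mulNr normrN ger0_norm// divr_ge0// ltW.
rewrite [leRHS](_ : _ = (`|q / 12| + `|- q / 20| + q / 5)
  * (4 / q ^+ 6 / n%:R ^+ 3)); last by rewrite q12 q20; ring.
apply: (binmean_expansion (a1 := q)) => //; first by rewrite divr_ge0 ?ltW.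
move=> k _ /=; set t := reldev n k; have Ek := reldev1D k n0; rewrite -/t in Ek.
have -> : k%:R / n%:R / q = 1 + t :> R by rewrite -Ek; field; rewrite N_neq0 q_neq0.
have -> : k%:R / n%:R = q * (1 + t) :> R by rewrite -Ek; field; rewrite N_neq0.
have t1 : 0 <= 1 + t.
  have : 0 <= n%:R * q * (1 + t) by rewrite Ek.
  by rewrite pmulr_rge0// mulr_gt0.
have /andP[] := xlogx_taylor_bounds t1; rewrite addrC addKr => lo up.
rewrite [X in `|X|](_ : _ = q * ((1 + t) * ln (1 + t) - xlogx_taylor t)); last first.
  by rewrite /xlogx_taylor; ring.
rewrite normrM (gtr0_norm q_gt0) [leRHS](_ : _ = q * (t ^+ 6 / 5)); last by ring.
rewrite ler_pM2l// ger0_norm ?subr_ge0//.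
by rewrite lerBlDl.
Qed.

(** Falling below half the mean forces a large sixth power, so events of this
    kind have probability O(n^-3). *)
Lemma reldev_tail n k : (0 < n)%N -> k%:R < n%:R * q / 2 ->
  1 <= 64 * reldev n k ^+ 6.
Proof.
move=> n0; rewrite -(reldev1D k n0) ltr_pM2l; last first.
  by rewrite mulr_gt0// ltr0n.
move: (reldev n k) => t t2; have {}t2 : 1 <= 4 * t ^+ 2 by nra.
have : 1 <= (4 * t ^+ 2) ^+ 3 by rewrite exprn_ege1.
by lra.
Qed.

Lemma binmean_reldev6 n : (0 < n)%N ->
  binmean q n (fun k => reldev n k ^+ 6) <= 4 / q ^+ 6 / n%:R ^+ 3.
Proof. by move=> n0; have [_ _ _ _ []] := reldev_moments n0. Qed.

Lemma binmean_eq0 n : (0 < n)%N ->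
  binmean q n (fun k => (k == 0)%:R) <= 4 / q ^+ 6 / n%:R ^+ 3.
Proof.
move=> n0; apply: le_trans (binmean_reldev6 n0).
apply: le_binmean => [|k _]; first by rewrite ltW.
case: eqP => [->|_]; last by rewrite exprn_even_ge0.
have -> : reldev n 0 = -1; last by rewrite /=; lra.
by rewrite /reldev sub0r mulNr divff// mulf_neq0 ?(gt_eqF q_gt0)// pnatr_eq0 -lt0n.
Qed.

(** The remainder of the geometric series for 1 / (1 + t) after degree 5 is
    t^6 / (1 + t); divided by the mean it is t^6 / k, which is at most t^6 for
    k >= 1. The constant 6 / q comes from k = 0, where t = -1. *)
Lemma binmean_inv : exists2 K, 0 <= K & forall n, (0 < n)%N ->
  `|binmean q n (fun k => k%:R^-1) - ((n%:R * q)^-1 + (1 - q) / (n%:R * q) ^+ 2)|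
    <= K / n%:R ^+ 3.
Proof.
have q1 : 1 <= q^-1 by rewrite invf_ge1.
exists ((q^-1 + q^-1 + 6 / q) * (4 / q ^+ 6) + 2 / q ^+ 3).
  rewrite addr_ge0 ?divr_ge0 ?exprn_ge0 ?(ltW q_gt0)//.
  rewrite mulr_ge0 ?divr_ge0 ?exprn_ge0 ?(ltW q_gt0)//.
  by rewrite !addr_ge0 ?divr_ge0 ?invr_ge0 ?(ltW q_gt0).
move=> n n0; have N1 : 1 <= n%:R :> R by rewrite ler1n.
have N0 := lt_le_trans ltr01 N1.
have q_neq0 : q != 0 by rewrite gt_eqF.
have N_neq0 : n%:R != 0 :> R by rewrite gt_eqF.
set mu := n%:R * q; have mu0 : 0 < mu by rewrite mulr_gt0.
have mu_neq0 : mu != 0 by rewrite gt_eqF.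
have muq : mu^-1 <= q^-1 by rewrite lef_pV2 ?posrE// ler_peMl ?(ltW q_gt0).
have := @binmean_expansion n (fun k => k%:R^-1) mu^-1 (- mu^-1) mu^-1 (- mu^-1)
  mu^-1 (- mu^-1) (6 / q) n0 (divr_ge0 _ (ltW q_gt0)) => /(_ (ler0n _ _)).
rewrite normrN (@ger0_norm _ mu^-1) ?invr_ge0 ?(ltW mu0)// => H.
have {}H : `|binmean q n (fun k => k%:R^-1) - (mu^-1 + mu^-1 * ((1 - q) / (q * n%:R)) +
     (- mu^-1 * (1 - q) * (1 - 2 * q) + 3 * mu^-1 * (1 - q) ^+ 2) / (q * n%:R) ^+ 2)|
   <= (q^-1 + q^-1 + 6 / q) * (4 / q ^+ 6 / n%:R ^+ 3).
  apply: le_trans (H _) _ => {H}; last first.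
    rewrite ler_wpM2r ?divr_ge0 ?exprn_ge0 ?(ltW q_gt0) ?(ltW N0)//.
    by rewrite !lerD.
  move=> k _ /=; have := reldev1D k n0; rewrite -/mu; set t := reldev _ _.
  move=> Ek; case: k => [|k] in t Ek *.
    have -> : t = -1.
      by move/eqP: Ek; rewrite mulf_eq0 (negPf mu_neq0)/= addrC addr_eq0 => /eqP.
    rewrite invr0 [X in `|X|](_ : _ = - (6 * mu^-1)); last by ring.
    rewrite normrN ger0_norm ?mulr_ge0 ?invr_ge0 ?(ltW mu0)//.
    by rewrite [leRHS](_ : _ = 6 / q) ?ler_wpM2l//; ring.
  have k0 : k.+1%:R != 0 :> R by rewrite pnatr_eq0.
  have t0 : 1 + t != 0 by apply: contra_neq k0 => t0; rewrite -Ek t0 mulr0.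
  rewrite [X in `|X|](_ : _ = k.+1%:R^-1 * t ^+ 6); last first.
    by rewrite -Ek; field; rewrite mu_neq0 t0.
  rewrite normrM (@ger0_norm _ (t ^+ 6)) ?exprn_even_ge0// ler_wpM2r ?exprn_even_ge0//.
  rewrite ger0_norm ?invr_ge0// (@le_trans _ _ 1)//; last by lra.
  by rewrite invf_le1 ?ltr0n// ler1n.
(* The delta method also produces a term of order n^-3, moved to the error. *)
rewrite -[X in _ - X](addrK ((1 - q) * (2 - q) / (q * n%:R) ^+ 3)).
rewrite opprB addrA -addrAC; apply: le_trans (ler_normD _ _) _.
rewrite [leRHS]mulrDl lerD//.
  rewrite mulrA in H; apply: le_trans H; rewrite le_eqVlt; apply/orP; left.
  by apply/eqP; congr `|_ - _|; rewrite /mu; field; rewrite N_neq0.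
rewrite ger0_norm; last first.
  rewrite divr_ge0 ?exprn_ge0 ?mulr_ge0 ?(ltW q_gt0) ?(ltW N0)// subr_ge0//.
  by have := q_le1; lra.
rewrite exprMn [leRHS](_ : _ = 2 / (q ^+ 3 * n%:R ^+ 3)); last first.
  by field; rewrite N_neq0.
rewrite ler_wpM2r ?invr_ge0 ?mulr_ge0 ?exprn_ge0 ?(ltW q_gt0) ?(ltW N0)//.
by have := q_le1; have := q_gt0; nra.
Qed.

(** From 1 / k^2 = (1 / k - 1 / mu)^2 + 2 / (mu k) - 1 / mu^2 with mu = n q:
    [binmean_inv] handles the middle term, and the square is at most
    4 t^2 / mu^2 when k >= mu / 2, and 64 t^6 / q^2 otherwise by
    [reldev_tail]. *)
Lemma binmean_inv2 : exists2 K, 0 <= K & forall n, (0 < n)%N ->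
  `|binmean q n (fun k => k%:R^-1 ^+ 2) - (n%:R * q)^-1 ^+ 2| <= K / n%:R ^+ 3.
Proof.
have [K1 K10 HK1] := binmean_inv.
have q1 : 1 <= q^-1 by rewrite invf_ge1.
have qV0 : 0 < q^-1 by rewrite invr_gt0.
exists (4 * q^-1 ^+ 3 + 64 * q^-1 ^+ 2 * (4 / q ^+ 6) + 2 * q^-1 * K1 + 2 * q^-1 ^+ 3).
  by nonneg.
move=> n n0; have N1 : 1 <= n%:R :> R by rewrite ler1n.
have N0 := lt_le_trans ltr01 N1.
have q_neq0 : q != 0 by rewrite gt_eqF.
have N_neq0 : n%:R != 0 :> R by rewrite gt_eqF.
set mu := n%:R * q; have mu0 : 0 < mu by rewrite mulr_gt0.
have mu_neq0 : mu != 0 by rewrite gt_eqF.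
have muq : mu^-1 <= q^-1 by rewrite lef_pV2 ?posrE// ler_peMl ?(ltW q_gt0).
have muV0 : 0 < mu^-1 by rewrite invr_gt0.
pose S := binmean q n (fun k => (k%:R^-1 - mu^-1) ^+ 2).
have [S0 S1] : 0 <= S /\ S <= 4 * mu^-1 ^+ 2 * ((1 - q) / (q * n%:R))
    + 64 * q^-1 ^+ 2 * (4 / q ^+ 6 / n%:R ^+ 3).
  split.
    rewrite -[leLHS](binmean_cst q n); apply: le_binmean => [|k _]; first by rewrite ltW.
    exact: sqr_ge0.
  have [_ _ <- _ [_ _]] := reldev_moments n0.
  move/(ler_wpM2l (_ : 0 <= 64 * q^-1 ^+ 2)); rewrite mulr_ge0 ?sqr_ge0// => /(_ isT).
  rewrite -!binmeanZ => H; rewrite (le_trans _ (lerD (lexx _) H))// -binmeanD.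
  apply: le_binmean => [|k _]; first by rewrite ltW.
  have [kmu|kmu] := ltP k%:R (mu / 2).
    have tail := reldev_tail n0 kmu.
    have : (k%:R^-1 - mu^-1) ^+ 2 <= q^-1 ^+ 2.
      have kV : 0 <= (k%:R^-1 : R) <= 1.
        case: k {kmu tail} => [|k]; first by rewrite invr0 lexx ler01.
        by rewrite invr_ge0 ler0n invf_le1 ?ltr0n ?ler1n.
      by have /andP[kV0 kV1] := kV; nra.
    move=> /le_trans; apply; rewrite (@le_trans _ _ (q^-1 ^+ 2 * (64 * reldev n k ^+ 6)))//.
      by rewrite ler_peMr// sqr_ge0.
    rewrite mulrA [q^-1 ^+ 2 * _]mulrC lerDr mulr_ge0 ?sqr_ge0// mulr_ge0// sqr_ge0.
    by [].
  have k0 : 0 < k%:R :> R by rewrite (lt_le_trans _ kmu)// divr_gt0.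
  have k_neq0 : k%:R != 0 :> R by rewrite gt_eqF.
  rewrite (_ : _ - _ = - (k%:R^-1 * reldev n k)); last first.
    by rewrite /reldev /mu; field; rewrite ?k_neq0 ?q_neq0 ?N_neq0.
  rewrite sqrrN exprMn (@le_trans _ _ (4 * mu^-1 ^+ 2 * reldev n k ^+ 2))//.
    rewrite ler_wpM2r ?sqr_ge0// (_ : 4 * _ = (mu / 2)^-1 ^+ 2); last by field.
    rewrite ler_sqr ?nnegrE ?invr_ge0 ?ler0n ?(ltW mu0) ?divr_ge0 ?(ltW mu0)//.
    by rewrite lef_pV2 ?posrE ?divr_gt0.
  by rewrite lerDl mulr_ge0 ?exprn_even_ge0// mulr_ge0 ?sqr_ge0.
have -> : binmean q n (fun k => k%:R^-1 ^+ 2) - mu^-1 ^+ 2 =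
    S + 2 * mu^-1 * (binmean q n (fun k => k%:R^-1) - (mu^-1 + (1 - q) / mu ^+ 2))
    + 2 * (1 - q) / mu ^+ 3.
  have -> : binmean q n (fun k => k%:R^-1 ^+ 2) =
      S + 2 * mu^-1 * binmean q n (fun k => k%:R^-1) - mu^-1 ^+ 2.
    rewrite -[X in _ - X](binmean_cst q n) -mulN1r -!binmeanZ -!binmeanD.
    by apply: eq_binmean => k; ring.
  by field.
have {HK1} := HK1 n n0; rewrite -/mu; set E := _ - _ => HE.
have N3 : 0 < n%:R ^+ 3 :> R by rewrite exprn_gt0.
have S2 : S <= (4 * q^-1 ^+ 3 + 64 * q^-1 ^+ 2 * (4 / q ^+ 6)) / n%:R ^+ 3.
  apply: le_trans S1 _; rewrite [leRHS](_ : _ = 4 * q^-1 ^+ 3 / n%:R ^+ 3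
    + 64 * q^-1 ^+ 2 * (4 / q ^+ 6 / n%:R ^+ 3)); last by ring.
  rewrite lerD//.
  rewrite (_ : 4 * _ * _ = 4 * q^-1 ^+ 3 / n%:R ^+ 3 * (1 - q)); last first.
    by rewrite /mu; field; rewrite N_neq0.
  rewrite ler_piMr//; first by nonneg.
  by have := q_gt0; lra.
rewrite [leRHS](_ : _ = (4 * q^-1 ^+ 3 + 64 * q^-1 ^+ 2 * (4 / q ^+ 6)) / n%:R ^+ 3
  + 2 * q^-1 * (K1 / n%:R ^+ 3) + 2 * q^-1 ^+ 3 / n%:R ^+ 3); last by ring.
apply: le_trans (ler_normD _ _) (lerD (le_trans (ler_normD _ _) (lerD _ _)) _).
- by rewrite ger0_norm.
- rewrite normrM ger0_norm ?mulr_ge0 ?(ltW muV0)//; apply: ler_pM => //.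
    by rewrite mulr_ge0 ?(ltW muV0).
  by rewrite ler_wpM2l.
- rewrite (_ : 2 * (1 - q) / mu ^+ 3 = 2 * q^-1 ^+ 3 / n%:R ^+ 3 * (1 - q)); last first.
    by rewrite /mu; field; rewrite N_neq0.
  have C0 : 0 <= 2 * q^-1 ^+ 3 / n%:R ^+ 3.
    by nonneg.
  rewrite ger0_norm; last by rewrite mulr_ge0// subr_ge0.
  by rewrite ler_piMr//; have := q_gt0; lra.
Qed.

(** Small values of k, where the hypothesis o(k^-2) says nothing, have
    probability O(n^-3) and [e] is bounded there. *)
Lemma binmean_little_o (e : nat -> R) (B : R) : (forall k, `|e k| <= B) ->
  (forall eps, 0 < eps -> exists k0, forall k, (k0 <= k)%N ->
     `|e k| <= eps * k%:R^-1 ^+ 2) ->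
  forall eps, 0 < eps -> exists n0, forall n, (n0 <= n)%N ->
     binmean q n (fun k => `|e k|) <= eps / n%:R ^+ 2.
Proof.
move=> eB e_o eps eps0; have [K K0 HK] := binmean_inv2.
have B0 : 0 <= B := le_trans (normr_ge0 _) (eB 0%N).
pose d := eps * q ^+ 2 / 2.
have d0 : 0 < d by rewrite divr_gt0 ?mulr_gt0 ?exprn_gt0.
have [k0 Hk0] := e_o d d0.
pose L := d * K + B * 64 * (4 / q ^+ 6).
exists (Num.bound (k0%:R * 2 / q) + Num.bound (L * 2 / eps)).+1 => n Hn.
have n0 : (0 < n)%N by apply: leq_trans Hn.
have N0 : 0 < n%:R :> R by rewrite ltr0n.
have bnd (x : R) m : 0 <= x -> (Num.bound x <= m)%N -> x < m%:R.
  by move=> x0 xm; rewrite (lt_le_trans (archi_boundP x0))// ler_nat.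
have n1 : k0%:R < n%:R * q / 2.
  have := bnd (k0%:R * 2 / q) n (divr_ge0 (mulr_ge0 _ _) (ltW q_gt0)).
  move=> /(_ (ler0n _ _) (ler0n _ _)); rewrite ltr_pdivrMr// => H.
  rewrite ltr_pdivlMr// H// (leq_trans _ Hn)//.
  by rewrite (leq_trans (leq_addr _ _) (leqnSn _)).
have L0 : 0 <= L.
  by nonneg.
have n2 : L / n%:R <= eps / 2.
  have := bnd (L * 2 / eps) n (divr_ge0 (mulr_ge0 L0 (ler0n _ _)) (ltW eps0)).
  rewrite ltr_pdivrMr// => H.
  rewrite ler_pdivrMr// mulrAC ler_pdivlMr// [eps * _]mulrC ltW// H// (leq_trans _ Hn)//.
  by rewrite (leq_trans (leq_addl _ _) (leqnSn _)).
apply: (@le_trans _ _ (binmean q n (fun k => d * k%:R^-1 ^+ 2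
    + B * 64 * reldev n k ^+ 6))).
  apply: le_binmean => [|k _]; first by rewrite ltW.
  have t6 : 0 <= reldev n k ^+ 6 by rewrite exprn_even_ge0.
  have [kk0|kk0] := leqP k0 k.
    by rewrite (le_trans (Hk0 _ kk0))// lerDl mulr_ge0// mulr_ge0.
  apply: le_trans (eB k) _; rewrite (@le_trans _ _ (B * (64 * reldev n k ^+ 6)))//.
    rewrite ler_peMr// reldev_tail// (lt_trans _ n1)// ltr_nat//.
  by rewrite mulrA lerDr mulr_ge0 ?sqr_ge0 ?(ltW d0).
rewrite binmeanD !binmeanZ.
have H1 : binmean q n (fun k => k%:R^-1 ^+ 2) <= (n%:R * q)^-1 ^+ 2 + K / n%:R ^+ 3.
  by rewrite -lerBlDl (le_trans (ler_norm _) (HK _ n0)).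
have H6 := binmean_reldev6 n0.
have B640 : 0 <= B * 64 by rewrite mulr_ge0.
apply: le_trans (lerD (ler_wpM2l (ltW d0) H1) (ler_wpM2l B640 H6)) _.
rewrite [leLHS](_ : _ = (eps / 2 + L / n%:R) / n%:R ^+ 2); last first.
  by rewrite /L /d; field; rewrite !gt_eqF.
rewrite ler_wpM2r ?invr_ge0 ?sqr_ge0//; lra.
Qed.

End RelativeDeviation.

(** * Count vectors of random samples *)

Section Sampling.
Variable R : realType.

Definition incr (T : finType) (x : {ffun T -> nat}) (t : T) : {ffun T -> nat} :=
  [ffun s => (x s + (s == t))%N].

Section Mean.
Variables (T : finType) (q : T -> R).
Implicit Types F G : {ffun T -> nat} -> R.

Definition mean n F : R :=
  \sum_(w : {ffun 'I_n -> T}) sample_pr q w * F (counts w).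

Lemma countsE n (w : {ffun 'I_n -> T}) t :
  counts w t = (\sum_(k < n) (w k == t))%N.
Proof.
by rewrite ffunE -sum1_card big_mkcond; apply: eq_bigr => k _; rewrite inE; case: eqP.
Qed.

Lemma mean0 F : mean 0 F = F [ffun=> 0%N].
Proof.
have w0 (w w' : {ffun 'I_0 -> T}) : w = w' by apply/ffunP => -[].
pose e : {ffun 'I_0 -> T} := ffun0 (card_ord 0).
rewrite /mean (big_pred1 e) => [|w]; last by rewrite /= (w0 w e) eqxx.
rewrite /sample_pr big_ord0 mul1r; congr F; apply/ffunP => t.
by rewrite countsE big_ord0 ffunE.
Qed.

Definition add_draw n (p : T * {ffun 'I_n -> T}) : {ffun 'I_n.+1 -> T} :=
  [ffun i => oapp p.2 p.1 (unlift ord0 i)].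

(** Adding the first draw to the other n. Expectations over samples thus become
    iterates of an operator on functions of count vectors, and the
    distributional identities below are inductions on [n]. *)
Lemma meanS n F : mean n.+1 F = mean n (fun x => \sum_t q t * F (incr x t)).
Proof.
have bij : {on predT, bijective (@add_draw n)}.
  apply: onW_bij; exists (fun w : {ffun 'I_n.+1 -> T} =>
    (w ord0, [ffun i : 'I_n => w (lift ord0 i)])).
    move=> [t w]; rewrite /add_draw !ffunE unlift_none /=; congr pair.
    by apply/ffunP => i; rewrite !ffunE liftK.
  move=> w; apply/ffunP => i; rewrite ffunE /=.
  by case: unliftP => [j ->|->]; rewrite /= ?ffunE.
rewrite /mean (reindex _ bij) /=.
under [RHS]eq_bigr do rewrite mulr_sumr.
rewrite exchange_big pair_bigA; apply: eq_bigr => -[t w] _ /=.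
rewrite mulrA [sample_pr q w * _]mulrC; congr (_ * F _).
  rewrite /sample_pr big_ord_recl ffunE unlift_none /=; congr (_ * _).
  by apply: eq_bigr => k _; rewrite ffunE liftK.
apply/ffunP => s; rewrite [RHS]ffunE !countsE big_ord_recl ffunE unlift_none /=.
rewrite addnC [t == s]eq_sym; congr addn.
by apply: eq_bigr => k _; rewrite ffunE liftK.
Qed.

Lemma meanD n F G : mean n (fun x => F x + G x) = mean n F + mean n G.
Proof. by rewrite /mean -big_split; apply: eq_bigr => w _; rewrite mulrDr. Qed.

Lemma meanZ n c F : mean n (fun x => c * F x) = c * mean n F.
Proof. by rewrite /mean mulr_sumr; apply: eq_bigr => w _; rewrite mulrCA. Qed.

Lemma mean_sum n (U : finType) (F : U -> {ffun T -> nat} -> R) :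
  mean n (fun x => \sum_u F u x) = \sum_u mean n (F u).
Proof.
rewrite /mean exchange_big; apply: eq_bigr => w _; exact: mulr_sumr.
Qed.

Lemma eq_mean n F G :
  (forall w : {ffun 'I_n -> T}, F (counts w) = G (counts w)) ->
  mean n F = mean n G.
Proof. by move=> FG; apply: eq_bigr => w _; rewrite FG. Qed.

Lemma counts_total n (w : {ffun 'I_n -> T}) : (\sum_t counts w t)%N = n.
Proof.
under eq_bigr do rewrite countsE.
rewrite exchange_big -[RHS]card_ord -sum1_card; apply: eq_bigr => k _ /=.
by rewrite (bigD1 (w k))//= eqxx big1// => t; rewrite eq_sym => /negPf->.
Qed.

Section Probability.
Hypotheses (q_ge0 : forall t, 0 <= q t) (q_sum1 : \sum_t q t = 1).

Lemma sample_pr_ge0 n (w : {ffun 'I_n -> T}) : 0 <= sample_pr q w.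
Proof. by apply: prodr_ge0. Qed.

Lemma ler_norm_mean n F G :
  (forall w : {ffun 'I_n -> T}, `|F (counts w)| <= G (counts w)) ->
  `|mean n F| <= mean n G.
Proof.
move=> FG; apply: le_trans (ler_norm_sum _ _ _) _; apply: ler_sum => w _.
by rewrite normrM (ger0_norm (sample_pr_ge0 w)) ler_wpM2l// sample_pr_ge0.
Qed.

Lemma mean_cst n c : mean n (fun=> c) = c.
Proof.
elim: n => [|n IH]; first by rewrite mean0.
rewrite meanS -[RHS]IH; apply: eq_mean => w.
by rewrite -mulr_suml q_sum1 mul1r.
Qed.

Lemma mean_cell n t (f : nat -> R) :
  mean n (fun x => f (x t)) = binmean (q t) n f.
Proof.
elim: n f => [|n IH] f; first by rewrite mean0 ffunE.
have step x : \sum_s q s * f (incr x s t) =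
    q t * f (x t).+1 + (1 - q t) * f (x t).
  rewrite -q_sum1 (bigD1 t)//= [\sum_s _ in RHS](bigD1 t)//= addrAC subrr add0r.
  rewrite mulr_suml; congr (_ + _); first by rewrite ffunE eqxx addn1.
  by apply: eq_bigr => s /negPf st; rewrite ffunE eq_sym st addn0.
rewrite meanS (@eq_mean _ _ (fun x => q t * (f \o succn) (x t) + (1 - q t) * f (x t))).
  by rewrite meanD !meanZ !IH.
by move=> w; exact: step.
Qed.

End Probability.
End Mean.

Section Rows.
Variables (I : nat) (J : 'I_I -> nat) (m : category J -> R).
Hypotheses (m_gt0 : forall c, 0 < m c) (m_sum1 : \sum_c m c = 1).
Hypothesis J_gt0 : forall i, (0 < J i)%N.

Lemma sum_category (F : category J -> R) :
  \sum_c F c = \sum_i \sum_(j < J i) F (cell i j).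
Proof. by rewrite sig_big_dep /=; apply: eq_bigr => -[]. Qed.

Lemma first_stage_gt0 i : 0 < first_stage m i.
Proof.
rewrite /first_stage (bigD1 (Ordinal (J_gt0 i)))//= ltr_pwDl// sumr_ge0// => j _.
exact: ltW.
Qed.

Lemma first_stage_sum1 : \sum_i first_stage m i = 1.
Proof. by rewrite -m_sum1 sum_category. Qed.

Lemma first_stage_le1 i : first_stage m i <= 1.
Proof.
rewrite -first_stage_sum1 (bigD1 i)//= lerDl sumr_ge0// => k _.
exact: ltW (first_stage_gt0 k).
Qed.

Lemma second_stage_gt0 i j : 0 < second_stage m i 0 j.
Proof. by rewrite mxE divr_gt0// first_stage_gt0. Qed.

Lemma second_stage_sum1 i : \sum_j second_stage m i 0 j = 1.
Proof.
under eq_bigr do rewrite mxE.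
by rewrite -mulr_suml divff// gt_eqF// first_stage_gt0.
Qed.

(** Each draw falls in row [i] with probability [first_stage m i], and then
    follows the second-stage distribution: conditionally on its total, a row of
    counts is a multinomial sample of that size. *)
Lemma mean_row n i (H : {ffun 'I_(J i) -> nat} -> R) :
  mean m n (fun x => H (row_counts x i)) =
  binmean (first_stage m i) n (fun k => mean (second_stage m i 0) k H).
Proof.
elim: n H => [|n IH] H.
  by rewrite mean0 /= mean0; congr H; apply/ffunP => j; rewrite !ffunE.
have step x : \sum_c m c * H (row_counts (incr x c) i) =
    first_stage m i * (\sum_j second_stage m i 0 j * H (incr (row_counts x i) j))
    + (1 - first_stage m i) * H (row_counts x i).
  have -> : 1 - first_stage m i = \sum_(k | k != i) first_stage m k.
    by rewrite -first_stage_sum1 (bigD1 i)//= addrAC subrr add0r.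
  rewrite sum_category (bigD1 i)//= mulr_sumr [in X in _ = _ + X]mulr_suml.
  congr (_ + _); apply: eq_bigr.
    move=> j _; rewrite mulrA mxE mulrCA divff ?mulr1 ?gt_eqF ?first_stage_gt0//.
    congr (_ * H _); apply/ffunP => j'; rewrite !ffunE; congr addn.
    by rewrite /cell eq_Tagged.
  move=> k /negPf ki; rewrite mulr_suml; apply: eq_bigr => j _; congr (_ * H _).
  apply/ffunP => j'; rewrite !ffunE -[RHS]addn0; congr addn.
  case: eqP => // /(congr1 tag)/= ik; move: ki; by rewrite ik eqxx.
rewrite meanS (@eq_mean _ _ _ _ (fun x => first_stage m i *
    (\sum_j second_stage m i 0 j * H (incr (row_counts x i) j))
    + (1 - first_stage m i) * H (row_counts x i))) => [|w]; last exact: step.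
rewrite meanD !meanZ IH mean_sum /=; congr (_ * _ + _).
under eq_bigr do rewrite meanZ (IH (fun y => H (incr y _))).
under eq_bigr do rewrite -binmeanZ.
rewrite -binmean_sum; apply: eq_binmean => k /=.
by rewrite meanS mean_sum; apply: eq_bigr => j _; rewrite meanZ.
Qed.

Lemma row_total_counts (x : {ffun category J -> nat}) i :
  row_total x i = (\sum_j row_counts x i j)%N.
Proof. by apply: eq_bigr => j _; rewrite ffunE. Qed.

Lemma mean_row_total n i (h : nat -> R) (g : {ffun 'I_(J i) -> nat} -> R) :
  mean m n (fun x => h (row_total x i) * g (row_counts x i)) =
  binmean (first_stage m i) n (fun k => h k * mean (second_stage m i 0) k g).
Proof.
pose H (y : {ffun 'I_(J i) -> nat}) := h (\sum_j y j)%N * g y.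
have -> : (fun x : {ffun category J -> nat} => h (row_total x i) * g (row_counts x i)) =
    (fun x => H (row_counts x i)).
  by apply/funext => x; rewrite /H row_total_counts.
rewrite mean_row; apply: eq_binmean => k; rewrite -meanZ.
by apply: eq_mean => w; rewrite /H counts_total.
Qed.

End Rows.
End Sampling.

(** * Maximum likelihood estimators *)

Section Estimators.
Variable R : realType.

Lemma closure_rowP (J : nat) (A : set 'rV[R]_J) (q : 'rV[R]_J) :
  closure A q <->
  forall e : R, 0 < e -> exists2 r, A r & forall j, `|q 0 j - r 0 j| < e.
Proof.
split=> [Aq e e0|Aq B /nbhs_ballP[e /= e0 Bq]].
  have [r [Ar [_ qr]]] := Aq _ (nbhsx_ballx q e e0).
  by exists r => // j; have := qr 0 j.
have [r Ar qr] := Aq e e0; exists r; split=> //; apply: Bq; split=> //.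
by move=> i j; rewrite ord1; exact: qr.
Qed.

Lemma closure_model_prob (J : nat) (S : parametric_model R J) (q : 'rV[R]_J) :
  closure (model_set S) q -> (forall j, 0 <= q 0 j) /\ \sum_j q 0 j = 1.
Proof.
move=> /closure_rowP Sq; have {}Sq e : 0 < e ->
    exists2 r : 'rV[R]_J, open_simplex r & forall j, `|q 0 j - r 0 j| < e.
  move=> /Sq[_ [th Sth <-] qr]; exists (param th) => //.
  exact: param_prob.
split=> [j|].
  rewrite leNgt; apply/negP => qj; have [|r [r0 _] /(_ j)] := Sq (- q 0 j).
    by rewrite oppr_gt0.
  by rewrite ltr_norml opprK => /andP[+ _]; have := r0 j; lra.
apply/eqP; rewrite -subr_eq0 -normr_le0; apply/ler_addgt0Pl => e e0; rewrite addr0.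
have e1 : 0 < e / J.+1%:R by rewrite divr_gt0.
have [r [_ r1] qr] := Sq _ e1; rewrite -r1 -sumrB.
apply: le_trans (ler_norm_sum _ _ _) _.
apply: (@le_trans _ _ (\sum_(j < J) e / J.+1%:R)).
  by apply: ler_sum => j _; rewrite ltW.
rewrite sumr_const card_ord -[leLHS]mulr_natr -mulrA ler_piMr ?(ltW e0)//.
by rewrite mulrC ler_pdivrMr// mul1r ler_nat.
Qed.

Definition frequency (J : nat) (x : {ffun 'I_J -> nat}) : 'rV[R]_J :=
  \row_j ((x j)%:R / (\sum_j x j)%:R).

(** If q differs from the frequencies f where x_j > 0, then y_j = q_j / f_j
    satisfies y_j <= exp (y_j - 1), strictly somewhere, so the likelihood
    ratio is less than exp (sum_j x_j (y_j - 1)) <= 1. This contradicts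
    maximality, because f lies in the closure of the simplex. Equality where
    x_j > 0 forces equality everywhere, as both vectors have total 1. *)
Lemma full_MLE (J : nat) (S : parametric_model R J) (x : {ffun 'I_J -> nat}) q :
  (0 < J)%N -> full_model S -> (0 < \sum_j x j)%N -> is_MLE S x q ->
  q = frequency x.
Proof.
move=> J0 [_ S_full] x0 [Sq q_max].
have [q0 q1] := closure_model_prob Sq; rewrite S_full in q_max.
set n := (\sum_j x j)%N in x0 *; have n0 : 0 < n%:R :> R by rewrite ltr0n.
have f_sum1 : \sum_j frequency x 0 j = 1.
  under eq_bigr do rewrite mxE.
  by rewrite -mulr_suml -natr_sum divff// gt_eqF.
have fE j : frequency x 0 j = (x j)%:R / n%:R by rewrite mxE.
have f_ge0 j : 0 <= frequency x 0 j by rewrite fE divr_ge0.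
have f_le1 j : frequency x 0 j <= 1.
  by rewrite -f_sum1 (bigD1 j)//= lerDl sumr_ge0.
have clf : closure (open_simplex (R := R) (J := J)) (frequency x).
  apply/closure_rowP => e e0; pose d := Num.min e 1 / 2.
  have m0 : 0 < Num.min e 1 by rewrite lt_min e0 ltr01.
  have me : Num.min e 1 <= e by rewrite ge_min lexx.
  have m1 : Num.min e 1 <= 1 by rewrite ge_min lexx orbT.
  have J0' : 0 < J%:R :> R by rewrite ltr0n.
  have J1 : J%:R^-1 <= 1 :> R by rewrite invf_le1// ler1n.
  have JV0 : 0 < J%:R^-1 :> R by rewrite invr_gt0.
  (* The mixture of the frequencies with the uniform distribution is interior
     to the simplex. *)
  exists (\row_j ((1 - d) * frequency x 0 j + d * J%:R^-1)).
    split=> [j|].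
      by rewrite mxE ltr_wpDl ?mulr_ge0 ?mulr_gt0//; rewrite /d; lra.
    under eq_bigr do rewrite mxE.
    rewrite big_split/= -!mulr_sumr f_sum1 sumr_const card_ord -[_ *+ J]mulr_natr.
    by rewrite mulVf ?gt_eqF//; ring.
  move=> j; rewrite [X in _ - X]mxE (_ : _ - _ = d * (frequency x 0 j - J%:R^-1));
    last by ring.
  have d0 : 0 < d by rewrite /d; lra.
  rewrite normrM gtr0_norm// (@le_lt_trans _ _ (d * 1))//; last by rewrite /d; lra.
  rewrite ler_pM2l// ler_norml; have := f_ge0 j; have := f_le1 j.
  by move=> *; apply/andP; split; lra.
have lik := q_max _ clf.
have f_gt0 j : x j != 0%N -> 0 < frequency x 0 j.
  by rewrite -lt0n => xj; rewrite fE divr_gt0 ?ltr0n.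
have lik0 : 0 < likelihood x (frequency x).
  rewrite /likelihood prodr_gt0// => j _.
  by have [->|/f_gt0] := eqVneq (x j) 0%N; [rewrite expr0|exact: exprn_gt0].
have q_gt0 j : x j != 0%N -> 0 < q 0 j.
  move=> xj; rewrite lt_neqAle q0 andbT; apply/negP => /eqP qj.
  have := lt_le_trans lik0 lik.
  by rewrite /likelihood (bigD1 j)//= -qj expr0n (negPf xj) mul0r ltxx.
have q_f j : x j != 0%N -> q 0 j = frequency x 0 j.
  move=> xj; apply/eqP/negPn/negP => qf.
  pose y k := q 0 k / frequency x 0 k.
  have y0 k : 0 <= y k by rewrite divr_ge0.
  have y_exp k : y k <= expR (y k - 1).
    by have := expR_ge1Dx (y k - 1); rewrite subrKC.
  have yj : y j < expR (y j - 1).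
    have := @expR_gt1Dx R (y j - 1); rewrite subrKC; apply.
    rewrite subr_eq0; apply: contra qf => /eqP y1.
    by rewrite -[X in _ == X]mul1r -y1 /y divfK// gt_eqF ?f_gt0.
  have likq : likelihood x q = likelihood x (frequency x) * \prod_k y k ^+ x k.
    rewrite /likelihood -big_split/=; apply: eq_bigr => k _.
    have [->|xk] := eqVneq (x k) 0%N; first by rewrite !expr0 mulr1.
    by rewrite -exprMn mulrC /y divfK// gt_eqF ?f_gt0.
  have lt_exp : \prod_k y k ^+ x k < \prod_k expR ((x k)%:R * (y k - 1)).
    rewrite (bigD1 j)//= [ltRHS](bigD1 j)//=.
    have le_rest : \prod_(k | k != j) y k ^+ x k <=
        \prod_(k | k != j) expR ((x k)%:R * (y k - 1)).
      apply: ler_prod => k _; rewrite exprn_ge0//= expRM_natl.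
      by rewrite lerXn2r ?nnegrE ?expR_ge0.
    apply: le_lt_trans (ler_wpM2l _ le_rest) _; first by rewrite exprn_ge0.
    rewrite ltr_pM2r ?prodr_gt0//; last by move=> k _; exact: expR_gt0.
    by rewrite expRM_natl ltrXn2r ?nnegrE ?expR_ge0.
  have le0 : \sum_k (x k)%:R * (y k - 1) <= 0.
    rewrite [leLHS](_ : _ = \sum_k ((x k)%:R * y k) - n%:R); last first.
      rewrite natr_sum -sumrB; apply: eq_bigr => k _; ring.
    have -> : n%:R = \sum_k n%:R * q 0 k by rewrite -mulr_sumr q1 mulr1.
    rewrite subr_le0; apply: ler_sum => k _.
    have [->|xk] := eqVneq (x k) 0%N; first rewrite mul0r.
      by apply: mulr_ge0; [exact: ltW|exact: q0].
    rewrite le_eqVlt; apply/orP; left; apply/eqP.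
    by rewrite /y fE; field; rewrite !pnatr_eq0 xk -lt0n x0.
  have lt1 : \prod_k y k ^+ x k < 1.
    by apply: (lt_le_trans lt_exp); rewrite -expR_sum -[leRHS]expR0 ler_expR.
  by move: lik; rewrite likq leNgt gtr_pMr// lt1.
apply/rowP => j; have [xj|] := eqVneq (x j) 0%N; last exact: q_f.
have : \sum_k (q 0 k - frequency x 0 k) = 0 by rewrite sumrB q1 f_sum1 subrr.
have d_ge0 k : 0 <= q 0 k - frequency x 0 k.
  by have [xk|/q_f->] := eqVneq (x k) 0%N; [rewrite fE xk mul0r subr0|rewrite subrr].
move/eqP; rewrite psumr_eq0// => /allP/(_ j); rewrite mem_index_enum => /(_ isT).
by rewrite subr_eq0 => /eqP.
Qed.

End Estimators.

(** * Errors of order o(n^-2) *)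

Section Negligible.
Variable R : realType.
Implicit Types e : nat -> nat -> R.

(** An error o(n^-2), uniformly in the size [ns] of the prior survey. *)
Definition o_inv_sq e : Prop := forall eps, 0 < eps ->
  exists n0, forall n ns, (n0 <= n)%N -> `|e n ns| <= eps / n%:R ^+ 2.

Lemma eq_o_inv_sq e e' : (forall n ns, (0 < n)%N -> e n ns = e' n ns) ->
  o_inv_sq e' -> o_inv_sq e.
Proof.
move=> ee' e'0 eps /e'0[n0 Hn0]; exists n0.+1 => n ns nn0.
by rewrite ee'; [apply: Hn0; exact: ltnW|exact: leq_trans nn0].
Qed.

Lemma o_inv_sq0 : o_inv_sq (fun _ _ => 0).
Proof.
by move=> eps eps0; exists 0%N => n ns _; rewrite normr0; nonneg.
Qed.

Lemma o_inv_sq_cube e K : (forall n ns, (0 < n)%N -> `|e n ns| <= K / n%:R ^+ 3) ->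
  o_inv_sq e.
Proof.
move=> eK eps eps0; exists (Num.bound (`|K| / eps)).+1 => n ns nn0.
have n0 : (0 < n)%N by apply: leq_trans nn0.
have N0 : 0 < n%:R :> R by rewrite ltr0n.
apply: le_trans (eK n ns n0) _.
rewrite exprS invfM mulrA ler_wpM2r ?invr_ge0 ?exprn_ge0 ?ler0n//.
apply: le_trans (ler_wpM2r _ (ler_norm K)) _; first by rewrite invr_ge0 ltW.
rewrite ler_pdivrMr// mulrC -ler_pdivrMr// ltW//.
apply: lt_le_trans (archi_boundP _) _; first by nonneg.
by rewrite ler_nat ltnW.
Qed.

Lemma o_inv_sqD e1 e2 : o_inv_sq e1 -> o_inv_sq e2 ->
  o_inv_sq (fun n ns => e1 n ns + e2 n ns).
Proof.
move=> e10 e20 eps eps0; have eps2 : 0 < eps / 2 by rewrite divr_gt0.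
have [[n1 H1] [n2 H2]] := (e10 _ eps2, e20 _ eps2).
exists (maxn n1 n2) => n ns; rewrite geq_max => /andP[/H1 + /H2].
move=> /(_ ns) {}H1 /(_ ns) {}H2; apply: le_trans (ler_normD _ _) _.
by apply: le_trans (lerD H1 H2) _; rewrite -mulrDl -splitr.
Qed.

Lemma o_inv_sq_sum (T : finType) (e : T -> nat -> nat -> R) :
  (forall t, o_inv_sq (e t)) -> o_inv_sq (fun n ns => \sum_t e t n ns).
Proof.
move=> e0; elim: (index_enum T) => [|t r IH].
  by apply: eq_o_inv_sq o_inv_sq0 => n ns _; rewrite big_nil.
apply: eq_o_inv_sq (o_inv_sqD (e0 t) IH) => n ns _.
by rewrite big_cons.
Qed.

Lemma o_inv_sq_expands f g :
  o_inv_sq (fun n ns => f n ns - g n ns) -> expands_to f g.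
Proof.
move=> fg; exists (fun N => f N.1 N.2 - g N.1 N.2), (fun=> 0); split.
- apply/eqoP => eps eps0; have [n0 Hn0] := fg eps eps0.
  near=> N; rewrite [in leRHS]normfV [in leRHS]normrX normr_nat.
  apply: Hn0; near: N.
  exists ([set n | (n0 <= n)%N], setT) => /=.
    by split; [exact: nbhs_infty_ge|exact: filterT].
  by move=> [n ns] /= [].
- by apply/eqoP => eps eps0; near=> N; rewrite normr0 mulr_ge0 ?(ltW eps0).
- by move=> n ns; rewrite addr0 subrKC.
Unshelve. all: by end_near. Qed.

Lemma finite_cube_bound (T : finType) (e : T -> nat -> R) :
  (forall t, exists K, forall n, (0 < n)%N -> `|e t n| <= K / n%:R ^+ 3) ->
  exists K, forall n, (0 < n)%N -> `|\sum_t e t n| <= K / n%:R ^+ 3.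
Proof.
move=> /choice[K HK]; exists (\sum_t K t) => n n0.
by rewrite mulr_suml; apply: le_trans (ler_norm_sum _ _ _) _; apply: ler_sum => t _; exact: HK.
Qed.

End Negligible.

(** * Risk of one second-stage estimator *)

Section SecondStage.
Variable R : realType.

Lemma KL_bound (T : finType) (p r : T -> R) : (forall t, 0 <= p t) ->
  \sum_t p t = 1 -> (forall t, 0 < r t) ->
  `|KL p r| <= \sum_t (1 + `|ln (r t)|).
Proof.
move=> p0 p1 r0; apply: le_trans (ler_norm_sum _ _ _) _; apply: ler_sum => t _.
apply: norm_xlogx_ratio => //; rewrite p0/= -p1 (bigD1 t)//= lerDl.
by apply: sumr_ge0.
Qed.

Section Row.
Variables (J : nat) (S : parametric_model R J).
Variables (phat : {ffun 'I_J -> nat} -> 'rV[R]_J) (q : 'rV[R]_J).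
Hypothesis phat_MLE : forall x : {ffun 'I_J -> nat}, (0 < \sum_j x j)%N -> is_MLE S x (phat x).
Hypotheses (q_gt0 : forall j, 0 < q 0 j) (q_sum1 : \sum_j q 0 j = 1).

Lemma second_stage_riskE n :
  second_stage_risk phat q n = mean (q 0) n (fun x => KL (phat x 0) (q 0)).
Proof. by []. Qed.

Lemma second_stage_risk_bound n : (0 < n)%N ->
  `|second_stage_risk phat q n| <= \sum_j (1 + `|ln (q 0 j)|).
Proof.
move=> n0; rewrite second_stage_riskE -[leRHS](mean_cst q_sum1 n).
apply: ler_norm_mean => [j|w]; first exact: ltW.
have [|ph _] := phat_MLE (x := counts w); first by rewrite counts_total.
by have [p0 p1] := closure_model_prob ph; exact: KL_bound.
Qed.

(** The estimator is the vector of frequencies, so its loss is a sum over cells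
    of x ln (x / q_j) at x = X_j / n with X_j binomial. *)
Lemma full_second_order_coef : full_model S ->
  has_second_order_coef S phat q (2 * (\sum_j (q 0 j)^-1 - 1)).
Proof.
move=> S_full; have J0 : (0 < J)%N.
  case: J S phat q phat_MLE q_gt0 q_sum1 S_full => // ? ? q' _ _.
  by rewrite big_ord0 => /esym/eqP; rewrite oner_eq0.
have q_le1 j : q 0 j <= 1.
  by rewrite -q_sum1 (bigD1 j)//= lerDl sumr_ge0// => k _; exact: ltW.
have [|K HK] := @finite_cube_bound R _ (fun j n =>
    binmean (q 0 j) n (fun k => k%:R / n%:R * ln (k%:R / n%:R / q 0 j))
    - ((1 - q 0 j) / (2 * n%:R) + ((q 0 j)^-1 - q 0 j) / (12 * n%:R ^+ 2))).
  by move=> j; exact: binmean_xlogx.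
apply/eqoP => eps eps0.
have [n0 Hn0] := o_inv_sq_cube (fun n (_ : nat) => HK n) eps0.
near=> n; have n_gt0 : (0 < n)%N by near: n; exact: nbhs_infty_gt.
have nn0 : (n0 <= n)%N by near: n; exact: nbhs_infty_ge.
rewrite [in leRHS]normfV [in leRHS]normrX normr_nat.
apply: le_trans (Hn0 n 0%N nn0); rewrite le_eqVlt; apply/orP; left; apply/eqP.
congr `|_|; rewrite sumrB; congr (_ - _).
  under eq_bigr do rewrite -mean_cell//.
  rewrite -mean_sum second_stage_riskE; apply: eq_mean => w.
  rewrite /KL; apply: eq_bigr => j _.
  have wn := counts_total w.
  rewrite (full_MLE J0 S_full _ (phat_MLE _)) ?wn//.
  by rewrite mxE wn.
have [Sdim _] := S_full.
rewrite big_split/= -!mulr_suml !sumrB q_sum1 sumr_const card_ord.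
rewrite Sdim -subn1 natrB//; field.
by rewrite pnatr_eq0 -lt0n.
Unshelve. all: by end_near. Qed.

End Row.

End SecondStage.

Section Weighted.
Variables (R : realType) (J : nat) (S : parametric_model R J).
Variables (phat : {ffun 'I_J -> nat} -> 'rV[R]_J) (q : 'rV[R]_J).
Hypothesis phat_MLE : forall x : {ffun 'I_J -> nat},
  (0 < \sum_j x j)%N -> is_MLE S x (phat x).
Hypotheses (q_gt0 : forall j, 0 < q 0 j) (q_sum1 : \sum_j q 0 j = 1).
Variables (m A : R).
Hypotheses (m_gt0 : 0 < m) (m_le1 : m <= 1).
Hypothesis phat_coef : has_second_order_coef S phat q A.
Let s : R := (model_dim S)%:R.

(** The contribution of one row to the second-stage risk, with
    (k + ns m) / (n + ns) the expected pooled weight of the row when its present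
    count is [k]. Multiplying s / (2 k) + A / (24 k^2) by k leaves
    s / 2 + A / (24 k) for k >= 1, so that the present counts contribute
    through E[1 / X] alone and the prior ones through E[1 / X] and
    E[1 / X^2]. *)
Lemma binmean_weighted_risk : o_inv_sq (fun n ns =>
  binmean m n (fun k => (k%:R + ns%:R * m) / (n + ns)%:R * (k != 0%N)%:R
    * second_stage_risk phat q k)
  - (s / (2 * n%:R) + 1 / (24 * n%:R ^+ 2) *
       (m^-1 * (A + 12 * (1 - m) * s * (ns%:R / (n + ns)%:R))))).
Proof.
pose main (k : nat) : R := s / 2 * k%:R^-1 + A / 24 * k%:R^-1 ^+ 2.
pose e k : R := (k != 0%N)%:R * second_stage_risk phat q k - main k.
pose B : R := \sum_j (1 + `|ln (q 0 j)|) + (`|s / 2| + `|A / 24|).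
have eB k : `|e k| <= B.
  rewrite /e /main; apply: le_trans (ler_normB _ _) _; rewrite lerD//.
    have [->|k0] := eqVneq k 0%N; last first.
      by rewrite mul1r; apply: (second_stage_risk_bound phat_MLE q_gt0 q_sum1); rewrite lt0n.
    by rewrite mul0r normr0 sumr_ge0// => j _; rewrite addr_ge0.
  have kV : `|k%:R^-1 : R| <= 1.
    case: k => [|k]; first by rewrite invr0 normr0.
    by rewrite ger0_norm ?invr_ge0// invf_le1 ?ltr0n// ler1n.
  apply: le_trans (ler_normD _ _) _; rewrite !normrM; rewrite lerD//.
    by rewrite ler_piMr// mulr_ge0.
  by rewrite ler_piMr ?mulr_ge0// mulr_ile1.
have e_o eps : 0 < eps -> exists k0, forall k, (k0 <= k)%N ->
    `|e k| <= eps * k%:R^-1 ^+ 2.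
  move=> eps0; have /eqoP /(_ eps eps0) [k0 _ Hk0] := phat_coef.
  exists k0.+1 => k kk0; have k_gt0 : (0 < k)%N by apply: leq_trans kk0.
  have := Hk0 k (ltnW kk0); rewrite /= normfV normrX normr_nat -exprVn.
  apply: le_trans; rewrite le_eqVlt; apply/orP; left; apply/eqP; congr `|_|.
  rewrite /e /main -lt0n k_gt0 [true%:R * _]mul1r /s; congr (_ - _); field.
  by rewrite pnatr_eq0 -lt0n.
have [K1 K10 HK1] := binmean_inv m_gt0 m_le1.
have [K2 K20 HK2] := binmean_inv2 m_gt0 m_le1.
pose Z n := binmean m n (fun k => (k == 0%N)%:R).
pose E1 n := binmean m n (fun k => k%:R^-1).
pose E2 n := binmean m n (fun k => k%:R^-1 ^+ 2).
pose w n ns k : R := (k%:R + ns%:R * m) / (n + ns)%:R.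
pose W n ns := binmean m n (fun k => w n ns k * e k).
have split_mean n ns : (0 < n)%N ->
    binmean m n (fun k => (k%:R + ns%:R * m) / (n + ns)%:R * (k != 0%N)%:R
      * second_stage_risk phat q k) =
    (n + ns)%:R^-1 * (s / 2 * (1 - Z n) + A / 24 * E1 n)
    + ns%:R * m / (n + ns)%:R * (s / 2 * E1 n + A / 24 * E2 n) + W n ns.
  move=> n0; have -> : 1 - Z n = binmean m n (fun k => 1 + -1 * (k == 0%N)%:R).
    by rewrite binmeanD binmeanZ binmean_cst mulN1r.
  rewrite /E1 /E2 /W.
  rewrite -!(binmeanZ, binmeanD); apply: eq_binmean => k.
  rewrite -mulrA (_ : _ * second_stage_risk _ _ _ = main k + e k); last first.
    by rewrite /e subrKC.
  rewrite mulrDr -/(w n ns k); congr (_ + _); rewrite /main /w.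
  have [->|k0] := eqVneq k 0%N; first by rewrite invr0 /=; ring.
  by rewrite /=; field; rewrite -natrD !pnatr_eq0 k0 -lt0n addn_gt0 n0.
have W0 : o_inv_sq W.
  move=> eps /(binmean_little_o m_gt0 m_le1 eB e_o)[n0 Hn0].
  exists n0.+1 => n ns nn0; apply: le_trans (Hn0 n (ltnW nn0)).
  have n_gt0 : (0 < n)%N by apply: leq_trans nn0.
  apply: ler_norm_binmean => [|k kn]; first by rewrite ltW.
  have N0 : 0 < (n + ns)%:R :> R by rewrite ltr0n addn_gt0 n_gt0.
  rewrite normrM ler_piMl// ger0_norm; last first.
    by rewrite /w; nonneg.
  rewrite ler_pdivrMr// mul1r natrD lerD ?ler_nat// ler_piMr//.
(* The main terms add up by 1 / N + ns / (N n) = 1 / n, where N = n + ns. *)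
apply: (@eq_o_inv_sq _ _ (fun n ns => W n ns +
   ((n + ns)%:R^-1 * (s / 2) * (- Z n)
    + (n + ns)%:R^-1 * (A / 24) * (E1 n - (n%:R * m)^-1)
    + ns%:R * m / (n + ns)%:R * (s / 2)
        * (E1 n - ((n%:R * m)^-1 + (1 - m) / (n%:R * m) ^+ 2))
    + ns%:R * m / (n + ns)%:R * (A / 24) * (E2 n - (n%:R * m)^-1 ^+ 2)))).
  move=> n ns n0; rewrite split_mean//.
  move: (W n ns) (Z n) (E1 n) (E2 n) => w' z' e1 e2; rewrite natrD; field.
  have N0 : 0 < n%:R :> R by rewrite ltr0n.
  by rewrite -natrD !pnatr_eq0 addn_eq0 negb_and -lt0n n0 gt_eqF.
apply: o_inv_sqD W0 _.
apply: (@o_inv_sq_cube _ _ (`|s / 2| * (4 / m ^+ 6) + `|A / 24| * (m^-1 ^+ 2 + K1)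
  + `|s / 2| * K1 + `|A / 24| * K2)) => n ns n0.
have N1 : 1 <= n%:R :> R by rewrite ler1n.
have N0 := lt_le_trans ltr01 N1.
have NN0 : 0 < (n + ns)%:R :> R by rewrite ltr0n addn_gt0 n0.
have a0 : 0 <= (n + ns)%:R^-1 :> R by rewrite invr_ge0.
have a1 : (n + ns)%:R^-1 <= n%:R^-1 :> R.
  by rewrite lef_pV2 ?posrE// ler_nat leq_addr.
have n1 : n%:R^-1 <= 1 :> R by rewrite invf_le1.
have b0 : 0 <= ns%:R * m / (n + ns)%:R by nonneg.
have b1 : ns%:R * m / (n + ns)%:R <= 1.
  rewrite ler_pdivrMr// mul1r natrD (@le_trans _ _ ns%:R)//; last by rewrite lerDr.
  by rewrite ler_piMr.
have HZ : `|Z n| <= 4 / m ^+ 6 / n%:R ^+ 3.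
  rewrite ger0_norm; first exact: binmean_eq0.
  rewrite -[leLHS](binmean_cst m n) /Z; apply: le_binmean => [|k _]; last exact: ler0n.
  by rewrite ltW.
have HE1 := HK1 n n0; rewrite -/(E1 n) in HE1.
have HE2 := HK2 n n0; rewrite -/(E2 n) in HE2.
have HE1' : `|E1 n - (n%:R * m)^-1| <= (m^-1 ^+ 2 + K1) / n%:R ^+ 2.
  rewrite (_ : _ - _ = (1 - m) / (n%:R * m) ^+ 2
     + (E1 n - ((n%:R * m)^-1 + (1 - m) / (n%:R * m) ^+ 2))); last by ring.
  apply: le_trans (ler_normD _ _) _; rewrite [leRHS]mulrDl lerD//.
    rewrite ger0_norm; last by rewrite divr_ge0 ?sqr_ge0// subr_ge0.
    rewrite exprMn invfM [_^-1 * _]mulrC mulrA ler_wpM2r ?invr_ge0 ?sqr_ge0//.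
    by rewrite -exprVn ler_piMl ?sqr_ge0//; have := m_gt0; lra.
  apply: le_trans HE1 _; rewrite ler_wpM2l// lef_pV2 ?posrE ?exprn_gt0//.
  exact: ler_weXn2l.
have scaled (c d x y z : R) : 0 <= c -> c <= z -> `|x| <= y -> `|c * d * x| <= `|d| * (y * z).
  move=> c0 cz xy; rewrite !normrM (ger0_norm c0) mulrAC [leRHS]mulrC.
  by rewrite ler_wpM2r// mulrC ler_pM.
rewrite [leRHS](_ : _ = `|s / 2| * (4 / m ^+ 6 / n%:R ^+ 3 * 1)
  + `|A / 24| * ((m^-1 ^+ 2 + K1) / n%:R ^+ 2 * n%:R^-1)
  + `|s / 2| * (K1 / n%:R ^+ 3 * 1) + `|A / 24| * (K2 / n%:R ^+ 3 * 1)); last first.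
  by field; rewrite !gt_eqF.
apply: le_trans (ler_normD _ _) (lerD (le_trans (ler_normD _ _)
  (lerD (le_trans (ler_normD _ _) (lerD _ _)) _)) _); apply: scaled => //.
- exact: le_trans n1.
- by rewrite normrN.
Qed.

End Weighted.

(** * Risk of the pooled estimator *)

Section Conditioning.
Variables (R : realType) (W : finType) (P : W -> R).
Hypotheses (P_ge0 : forall w, 0 <= P w) (P_sum1 : \sum_w P w = 1).

(** Conditioning on an event of probability close to 1 hardly changes the
    expectation of a bounded variable. *)
Lemma cond_expectation_close (G : pred W) (F F' : W -> R) C :
  (forall w, `|F' w| <= C) -> (forall w, G w -> F w = F' w) ->
  \sum_(w | ~~ G w) P w <= 1 / 2 ->
  `|cond_expectation P G F - \sum_w P w * F' w| <= 3 * C * \sum_(w | ~~ G w) P w.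
Proof.
move=> F'C FF' eps2; set eps := \sum_(w | _) _ in eps2 *.
have eps0 : 0 <= eps by apply: sumr_ge0.
pose a := \sum_(w | G w) P w * F' w; pose b := \sum_(w | ~~ G w) P w * F' w.
have PG : \sum_(w | G w) P w = 1 - eps.
  have : \sum_(w | G w) P w + eps = 1 by rewrite -P_sum1 [RHS](bigID G).
  by lra.
have -> : \sum_w P w * F' w = a + b by rewrite (bigID G).
have -> : cond_expectation P G F = a / (1 - eps).
  by rewrite /cond_expectation PG; congr (_ / _); apply: eq_bigr => w /FF'->.
have bound (Q : pred W) : `|\sum_(w | Q w) P w * F' w| <= C * \sum_(w | Q w) P w.
  rewrite mulr_sumr; apply: le_trans (ler_norm_sum _ _ _) _; apply: ler_sum => w _.
  by rewrite normrM (ger0_norm (P_ge0 w)) mulrC ler_wpM2r.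
have ha : `|a| <= C * (1 - eps) by rewrite -PG; exact: bound.
have hb : `|b| <= C * eps := bound _.
have d0 : 0 < 1 - eps by lra.
have -> : a / (1 - eps) - (a + b) = a / (1 - eps) * eps - b.
  by field; rewrite gt_eqF.
have ha' : `|a / (1 - eps)| <= C.
  by rewrite normrM normfV (gtr0_norm d0) ler_pdivrMr.
apply: le_trans (ler_normB _ _) _; rewrite normrM (ger0_norm eps0).
have := ler_wpM2r eps0 ha'.
have C0 : 0 <= C by apply: le_trans (normr_ge0 _) ha'.
have := mulr_ge0 C0 eps0; lra.
Qed.

End Conditioning.

Lemma mean_mean (R : realType) (T T' : finType) (q : T -> R) (q' : T' -> R) n n'
    (F : {ffun T -> nat} -> {ffun T' -> nat} -> R) :
  \sum_(w : {ffun 'I_n -> T} * {ffun 'I_n' -> T'})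
    sample_pr q w.1 * sample_pr q' w.2 * F (counts w.1) (counts w.2) =
  mean q n (fun x => mean q' n' (F x)).
Proof.
rewrite /mean; under [RHS]eq_bigr do rewrite mulr_sumr.
by rewrite pair_bigA; apply: eq_bigr => w _; rewrite mulrA.
Qed.

Section Pooled.
Variables (R : realType) (I : nat) (J : 'I_I -> nat) (m : category J -> R).
Variable S : forall i : 'I_I, parametric_model R (J i).
Variable phat : forall i : 'I_I, {ffun 'I_(J i) -> nat} -> 'rV[R]_(J i).
Hypothesis J_gt0 : forall i, (0 < J i)%N.
Hypotheses (m_gt0 : forall c, 0 < m c) (m_sum1 : \sum_c m c = 1).
Hypothesis phat_MLE : forall i (x : {ffun 'I_(J i) -> nat}),
  (0 < \sum_j x j)%N -> is_MLE (S i) x (phat x).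
Let mf := first_stage m.
Local Notation p i := (second_stage m i 0).
Let mf_gt0 i : 0 < mf i := first_stage_gt0 m_gt0 J_gt0 i.
Let p_gt0 i j : 0 < p i j := second_stage_gt0 m_gt0 J_gt0 j.

Definition first_stage_loss N i (k : nat) : R :=
  k%:R / N%:R * ln (k%:R / N%:R / mf i).

Definition second_stage_loss i (x : {ffun 'I_(J i) -> nat}) : R :=
  KL (phat x 0) (p i).

(** The loss of the pooled estimator split by the chain rule, and extended to
    samples with an empty row by dropping the second-stage loss of that row:
    the estimate from zero counts is arbitrary, and dropping it keeps the loss
    bounded. *)
Definition pooled_loss n ns (x : {ffun category J -> nat}) (y : {ffun 'I_I -> nat}) : R :=
  \sum_i (first_stage_loss (n + ns) i (row_total x i + y i) +
    (row_total x i + y i)%:R / (n + ns)%:R * (row_total x i != 0%N)%:R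
      * second_stage_loss (row_counts x i)).

(** Chain rule for the Kullback-Leibler divergence; a zero coordinate of the
    second-stage estimate contributes nothing to either side. *)
Lemma KL_pooled n ns x y : (0 < n)%N -> (forall i, row_total x i != 0%N) ->
  KL (pooled_estimator phat n ns x y) m = pooled_loss n ns x y.
Proof.
move=> n0 x0; rewrite /KL sum_category; apply: eq_bigr => i _.
set a : R := (row_total x i + y i)%:R / (n + ns)%:R.
have a0 : 0 < a by rewrite divr_gt0// ltr0n addn_gt0 ?n0// lt0n x0.
have [|/closure_model_prob[ph0 ph1] _] := phat_MLE (x := row_counts x i).
  by rewrite -row_total_counts lt0n.
transitivity (\sum_j (a * ln (a / mf i) * phat (row_counts x i) 0 j
    + a * (phat (row_counts x i) 0 j * ln (phat (row_counts x i) 0 j / p i j)))).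
  apply: eq_bigr => j _; rewrite /pooled_estimator /= -/a.
  set b := phat _ _ _; have := ph0 j; rewrite -/b le_eqVlt => /orP[/eqP<-|b0].
    by rewrite !(mulr0, mul0r, addr0).
  have mE : m (cell i j) = mf i * p i j.
    by rewrite mxE mulrC divfK// gt_eqF// mf_gt0.
  rewrite mE (_ : _ / _ = a / mf i * (b / p i j)); last by rewrite invfM mulrACA.
  have am : 0 < a / mf i := divr_gt0 a0 (mf_gt0 i).
  have bp : 0 < b / p i j := divr_gt0 b0 (p_gt0 j).
  by rewrite lnM ?posrE//; ring.
rewrite big_split/= -!mulr_sumr ph1 mulr1 /first_stage_loss -/a x0 mulr1.
by [].
Qed.

Lemma row_total_le n (w : {ffun 'I_n -> category J}) i :
  (row_total (counts w) i <= n)%N.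
Proof.
rewrite -[leqRHS](counts_total w).
have -> : (\sum_c counts w c = \sum_i row_total (counts w) i)%N.
  by rewrite /row_total sig_big_dep /=; apply: eq_bigr => -[].
by rewrite (bigD1 i)//= leq_addr.
Qed.

Lemma counts_le n (T : finType) (w : {ffun 'I_n -> T}) t : (counts w t <= n)%N.
Proof. by rewrite -[leqRHS](counts_total w) (bigD1 t)//= leq_addr. Qed.

Lemma pooled_loss_bound n ns (w : {ffun 'I_n -> category J})
    (w' : {ffun 'I_ns -> 'I_I}) : (0 < n)%N ->
  `|pooled_loss n ns (counts w) (counts w')| <=
  \sum_i (1 + `|ln (mf i)| + \sum_j (1 + `|ln (p i j)|)).
Proof.
move=> n0; apply: le_trans (ler_norm_sum _ _ _) _; apply: ler_sum => i _.
have NN0 : 0 < (n + ns)%:R :> R by rewrite ltr0n addn_gt0 n0.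
set k := (row_total _ i + _)%N.
have k01 : 0 <= (k%:R / (n + ns)%:R : R) <= 1.
  by rewrite divr_ge0//= ler_pdivrMr// mul1r ler_nat leq_add ?row_total_le ?counts_le.
apply: le_trans (ler_normD _ _) (lerD _ _); first exact: norm_xlogx_ratio.
have [xi|xi] := eqVneq (row_total (counts w) i) 0%N.
  by rewrite /= mulr0 mul0r normr0; apply: sumr_ge0 => j _; rewrite addr_ge0.
have [k0 k1] := andP k01; rewrite /= mulr1 normrM (ger0_norm k0).
have [|/closure_model_prob[ph0 ph1] _] := phat_MLE (x := row_counts (counts w) i).
  by rewrite -row_total_counts lt0n.
rewrite -[leRHS]mul1r ler_pM//; exact: KL_bound.
Qed.

(** Averaging over the prior survey replaces the weight of row [i] by
    its expectation, while the pooled count of the row is binomial. *)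
Lemma mean_pooled_loss n ns :
  mean m n (fun x => mean mf ns (pooled_loss n ns x)) =
  \sum_i (binmean (mf i) (n + ns) (first_stage_loss (n + ns) i) +
    binmean (mf i) n (fun k => (k%:R + ns%:R * mf i) / (n + ns)%:R
      * (k != 0%N)%:R * second_stage_risk (@phat i) (second_stage m i) k)).
Proof.
have mf_sum1 : \sum_i mf i = 1 := first_stage_sum1 m_sum1.
have inner x : mean mf ns (pooled_loss n ns x) =
    \sum_i (binmean (mf i) ns (fun l => first_stage_loss (n + ns) i (row_total x i + l))
      + ((row_total x i)%:R + ns%:R * mf i) / (n + ns)%:R
        * (row_total x i != 0%N)%:R * second_stage_loss (row_counts x i)).
  rewrite mean_sum; apply: eq_bigr => i _; rewrite meanD; congr (_ + _).
    exact: (mean_cell mf_sum1 ns i (fun l => first_stage_loss (n + ns) i (row_total x i + l))).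
  set c := (_ != _)%:R; set L := second_stage_loss _.
  rewrite (mean_cell mf_sum1 ns i (fun l => (row_total x i + l)%:R / (n + ns)%:R * c * L)).
  rewrite (@eq_binmean _ _ _ _ (fun l => (c * L / (n + ns)%:R) * ((row_total x i)%:R + l%:R))).
    by rewrite binmeanZ binmeanD binmean_cst binmean_id; ring.
  by move=> l; rewrite natrD; ring.
rewrite (@eq_mean _ _ _ _ _ (fun x => \sum_i (
    binmean (mf i) ns (fun l => first_stage_loss (n + ns) i (row_total x i + l)) * 1
      + ((row_total x i)%:R + ns%:R * mf i) / (n + ns)%:R
        * (row_total x i != 0%N)%:R * second_stage_loss (row_counts x i)))); last first.
  by move=> w; rewrite inner; apply: eq_bigr => i _; rewrite mulr1.
rewrite mean_sum; apply: eq_bigr => i _; rewrite meanD; congr (_ + _).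
  rewrite (mean_row_total m_gt0 m_sum1 J_gt0 n (i := i) (fun k => binmean (mf i) ns
    (fun l => first_stage_loss (n + ns) i (k + l))) (fun=> 1)) -binmean_add.
  apply: eq_binmean => k; rewrite mean_cst ?mulr1//.
  exact: second_stage_sum1.
exact: (mean_row_total m_gt0 m_sum1 J_gt0 n (i := i) (fun k => (k%:R + ns%:R * mf i)
  / (n + ns)%:R * (k != 0%N)%:R) (@second_stage_loss i)).
Qed.

Definition pooled_pr n ns (w : {ffun 'I_n -> category J} * {ffun 'I_ns -> 'I_I}) : R :=
  sample_pr m w.1 * sample_pr mf w.2.

Let missing n ns (w : {ffun 'I_n -> category J} * {ffun 'I_ns -> 'I_I}) :=
  ~~ [forall i, row_total (counts w.1) i != 0%N].

Let mf_le1 i : mf i <= 1 := first_stage_le1 m_gt0 m_sum1 J_gt0 i.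

(** A union bound over the rows, each of them controlled by a sixth moment. *)
Lemma pr_missing_le n ns : (0 < n)%N ->
  \sum_(w | missing w) pooled_pr (n := n) (ns := ns) w <=
  (\sum_i 4 / mf i ^+ 6) / n%:R ^+ 3.
Proof.
move=> n0; have mf_sum1 : \sum_i mf i = 1 := first_stage_sum1 m_sum1.
have P0 (w : {ffun 'I_n -> category J} * {ffun 'I_ns -> 'I_I}) : 0 <= pooled_pr w.
  by rewrite mulr_ge0// sample_pr_ge0// => c; exact: ltW.
apply: (@le_trans _ _ (\sum_(w : {ffun 'I_n -> category J} * {ffun 'I_ns -> 'I_I})
    pooled_pr w * \sum_i (row_total (counts w.1) i == 0%N)%:R)).
  rewrite big_mkcond; apply: ler_sum => w _; case: ifPn => [|_]; last first.
    by rewrite mulr_ge0// sumr_ge0.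
  move=> /forallPn[i /negPn xi]; rewrite ler_peMr// (bigD1 i)//= xi lerDl.
  exact: sumr_ge0.
rewrite (mean_mean m mf n ns (fun x _ => \sum_i (row_total x i == 0%N)%:R)).
rewrite (@eq_mean _ _ _ _ _ (fun x => \sum_i (row_total x i == 0%N)%:R * 1)); last first.
  by move=> w; rewrite mean_cst//; apply: eq_bigr => i _; rewrite mulr1.
rewrite mean_sum mulr_suml; apply: ler_sum => i _.
rewrite (mean_row_total m_gt0 m_sum1 J_gt0 n (i := i) (fun k => (k == 0%N)%:R) (fun=> 1)).
rewrite (@eq_binmean _ _ _ _ (fun k => (k == 0%N)%:R)); first exact: binmean_eq0.
by move=> k; rewrite mean_cst ?mulr1//; exact: second_stage_sum1.
Qed.

Lemma pooled_risk_close : o_inv_sq (fun n ns =>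
  pooled_risk phat m n ns - mean m n (fun x => mean mf ns (pooled_loss n ns x))).
Proof.
set C : R := \sum_i (1 + `|ln (mf i)| + \sum_j (1 + `|ln (p i j)|)).
set D : R := \sum_i 4 / mf i ^+ 6.
have mf_sum1 : \sum_i mf i = 1 := first_stage_sum1 m_sum1.
have D0 : 0 <= D.
  by apply: sumr_ge0 => i _; rewrite divr_ge0 ?exprn_ge0 ?(ltW (mf_gt0 i)).
move=> eps eps0.
have [n0 Hn0] : exists n0, forall n (_ : nat), (n0 <= n)%N ->
    `|3 * C * D / n%:R ^+ 3| <= eps / n%:R ^+ 2.
  apply: (@o_inv_sq_cube _ _ `|3 * C * D|) => // n _ n0.
  by rewrite normrM [X in _ * X]ger0_norm// invr_ge0 exprn_ge0.
exists (maxn n0 (Num.bound (2 * D)).+1) => n ns; rewrite geq_max => /andP[nn0 nD].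
have n_gt0 : (0 < n)%N by apply: leq_trans nD.
have N1 : 1 <= n%:R :> R by rewrite ler1n.
have N3 : 0 < n%:R ^+ 3 :> R by rewrite exprn_gt0// ltr0n.
have miss := @pr_missing_le n ns n_gt0; rewrite -/D in miss.
have half : D / n%:R ^+ 3 <= 1 / 2.
  rewrite ler_pdivrMr//; have := archi_boundP (mulr_ge0 (ler0n R 2) D0) => hD.
  have : (Num.bound (2 * D))%:R <= n%:R :> R by rewrite ler_nat ltnW.
  have : n%:R <= n%:R ^+ 3 :> R by rewrite -[leLHS]expr1 ler_weXn2l.
  by lra.
rewrite -(mean_mean m mf n ns (fun x y => pooled_loss n ns x y)).
apply: le_trans (Hn0 n ns nn0); apply: le_trans (ler_norm _).
have C0 : 0 <= C.
  apply: sumr_ge0 => i _; do 2?[apply: addr_ge0 => //].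
  by apply: sumr_ge0 => j _; exact: addr_ge0.
apply: le_trans (_ : 3 * C * \sum_(w | missing w) pooled_pr (n := n) (ns := ns) w
    <= _); last first.
  by rewrite -[leRHS]mulrA ler_wpM2l// mulr_ge0.
apply: cond_expectation_close.
- by move=> w; rewrite mulr_ge0// sample_pr_ge0// => c; exact: ltW.
- transitivity (mean m n (fun=> mean mf ns (fun=> 1))).
    rewrite -(mean_mean m mf n ns (fun _ _ => 1)).
    by apply: eq_bigr => w _; rewrite mulr1.
  rewrite (@eq_mean _ _ _ _ _ (fun=> 1)) => [|w]; exact: mean_cst.
- by move=> w; exact: pooled_loss_bound.
- by move=> w /forallP x0; exact: KL_pooled.
- exact: le_trans miss half.
Qed.

Variable A : 'I_I -> R.
Hypothesis phat_coef : forall i,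
  has_second_order_coef (S i) (@phat i) (second_stage m i) (A i).

(** Sum the expansions of the rows, using that the sum of 1 - m_i is I - 1 and
    that of 1 / m_i - m_i is M_f - 1. *)
Lemma pooled_risk_expansion :
  expands_to (pooled_risk phat m) (fun n ns =>
      1 / (2 * (n + ns)%:R) * (I%:R - 1)
      + 1 / (2 * n%:R) * \sum_i (model_dim (S i))%:R
      + 1 / (12 * (n + ns)%:R ^+ 2) * (\sum_i (mf i)^-1 - 1)
      + 1 / (24 * n%:R ^+ 2) *
          \sum_i (mf i)^-1 *
            (A i + 12 * (1 - mf i) * (model_dim (S i))%:R * (ns%:R / (n + ns)%:R))).
Proof.
have mf_sum1 : \sum_i mf i = 1 := first_stage_sum1 m_sum1.
apply: o_inv_sq_expands.
have [K HK] := @finite_cube_bound R _ (fun i N => binmean (mf i) N (first_stage_loss N i)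
   - ((1 - mf i) / (2 * N%:R) + ((mf i)^-1 - mf i) / (12 * N%:R ^+ 2)))
   (fun i => binmean_xlogx (mf_gt0 i) (mf_le1 i)).
have K0 : 0 <= K.
  have := HK 1%N isT; rewrite [leRHS](_ : _ = K); first exact: le_trans.
  by rewrite expr1n divr1.
have first : o_inv_sq (fun n ns => \sum_i (binmean (mf i) (n + ns) (first_stage_loss (n + ns) i)
   - ((1 - mf i) / (2 * (n + ns)%:R) + ((mf i)^-1 - mf i) / (12 * (n + ns)%:R ^+ 2)))).
  apply: (@o_inv_sq_cube _ _ K) => n ns n0.
  apply: le_trans (HK (n + ns)%N _) _; first by rewrite addn_gt0 n0.
  rewrite ler_wpM2l// lef_pV2 ?posrE ?exprn_gt0 ?ltr0n ?addn_gt0 ?n0//.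
  by rewrite lerXn2r ?nnegrE// ler_nat leq_addr.
have second := o_inv_sq_sum (fun i => binmean_weighted_risk (@phat_MLE i)
  (p_gt0 (i := i)) (second_stage_sum1 m_gt0 J_gt0 i) (mf_gt0 i) (mf_le1 i) (phat_coef i)).
apply: eq_o_inv_sq (o_inv_sqD pooled_risk_close (o_inv_sqD first second)) => n ns n0.
rewrite mean_pooled_loss !sumrB !big_split/= -!mulr_suml -!mulr_sumr !sumrB mf_sum1.
rewrite sumr_const card_ord.
ring.
Qed.

End Pooled.

Theorem theorem3 (R : realType) (I : nat) (J : 'I_I -> nat)
    (m : category J -> R)
    (S : forall i : 'I_I, parametric_model R (J i))
    (phat : forall i : 'I_I, {ffun 'I_(J i) -> nat} -> 'rV[R]_(J i))
    (J_gt0 : forall i, (1 <= J i)%N)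
    (m_gt0 : forall c, 0 < m c)
    (m_sum1 : \sum_c m c = 1)
    (m_model : forall i, model_set (S i) (second_stage m i))
    (phat_MLE : forall i (x : {ffun 'I_(J i) -> nat}),
      (0 < \sum_j x j)%N -> is_MLE (S i) x (phat i x)) :
  let mf := first_stage m in
  let s := fun i => (model_dim (S i))%:R : R in
  let Mf := \sum_i (mf i)^-1 in
  let M := \sum_i \sum_(j < J i) (m (cell i j))^-1 in
  let p := (\sum_i J i)%:R - 1 : R in
  (forall A : 'I_I -> R,
    (forall i, has_second_order_coef (S i) (phat i) (second_stage m i) (A i)) ->
    expands_to (pooled_risk phat m) (fun n ns =>
      1 / (2 * (n + ns)%:R) * (I%:R - 1)
      + 1 / (2 * n%:R) * \sum_i s i
      + 1 / (12 * (n + ns)%:R ^+ 2) * (Mf - 1)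
      + 1 / (24 * n%:R ^+ 2) *
          \sum_i (mf i)^-1 *
            (A i + 12 * (1 - mf i) * s i * (ns%:R / (n + ns)%:R))))
  /\
  ((forall i, full_model (S i)) ->
    expands_to (pooled_risk phat m) (fun n ns =>
      1 / (2 * (n + ns)%:R) * (I%:R - 1)
      + 1 / (2 * n%:R) * (p - I%:R + 1)
      + 1 / (12 * (n + ns)%:R ^+ 2) * (Mf - 1)
      + 1 / (12 * n%:R ^+ 2) *
          (M - Mf + 6 * ns%:R / (n + ns)%:R *
             (\sum_i (mf i)^-1 * (J i)%:R - Mf - (p - I%:R + 1))))).
Proof.
move=> mf s Mf M p.
have expansion A (HA : forall i,
    has_second_order_coef (S i) (phat i) (second_stage m i) (A i)) :=
  pooled_risk_expansion J_gt0 m_gt0 m_sum1 phat_MLE HA.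
split=> [|S_full]; first exact: expansion.
have mf0 i : 0 < mf i := first_stage_gt0 m_gt0 J_gt0 i.
have coef i := full_second_order_coef (phat_MLE i)
  (second_stage_gt0 m_gt0 J_gt0 (i := i)) (second_stage_sum1 m_gt0 J_gt0 i)
  (S_full i).
have := expansion _ coef; congr expands_to.
apply/funext => n; apply/funext => ns.
have dimE i : (model_dim (S i))%:R = (J i)%:R - 1 :> R.
  by have [-> _] := S_full i; rewrite -subn1 natrB.
have dim_sum : \sum_i (model_dim (S i))%:R = p - I%:R + 1.
  under eq_bigr do rewrite dimE.
  by rewrite sumrB sumr_const card_ord -natr_sum /p; ring.
set c : R := ns%:R / (n + ns)%:R.
have second_order : \sum_i (mf i)^-1 * (2 * (\sum_j (second_stage m i 0 j)^-1 - 1)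
      + 12 * (1 - mf i) * (model_dim (S i))%:R * c) =
    2 * (M - Mf) + 12 * c * (\sum_i (mf i)^-1 * (J i)%:R - Mf - (p - I%:R + 1)).
  rewrite -dim_sum /M /Mf -!sumrB !mulr_sumr -big_split/=; apply: eq_bigr => i _.
  rewrite (eq_bigr (fun j => mf i * (m (cell i j))^-1)); last first.
    by move=> j _; rewrite mxE invf_div.
  rewrite -mulr_sumr dimE; field; rewrite gt_eqF//; exact: mf0.
rewrite dim_sum second_order -/Mf; congr (_ + _).
have -> : 1 / (24 * n%:R ^+ 2) = 2^-1 * (1 / (12 * n%:R ^+ 2)) :> R.
  by move: (n%:R ^+ 2 : R) => x; rewrite !mul1r !invfM; move: x^-1 => y; field.
rewrite -[6 * ns%:R / _]mulrA -/c.
by move: (1 / (12 * n%:R ^+ 2) : R) => x; field.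
Qed.
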